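(* Let $A$ be a finite-dimensional Hopf algebra over an algebraically closed field $\mathbb{F}$ with $\ell+1$ isomorphism classes of simple modules, and let $V$ be an $A$-module. The following are equivalent: (i) $\overline{L_V}$ is a nonsingular $M$-matrix; (ii) $\overline{L_V}$ is nonsingular; (iii) $L_V$ has rank $\ell$ (so nullity $1$); (iv) the critical group $K(V)$ is finite; (v) $V$ is tensor-rich.
   Context: All modules are finite-dimensional left $A$-modules, tensor products are over $\mathbb{F}$ with action via the coproduct $\Delta(a)=\sum a_1\otimes a_2$, and $\epsilon$ denotes the trivial module ($\mathbb{F}$ with $a$ acting by the counit $\epsilon(a)$). Let $S_1,\dots,S_{\ell+1}$ be the simple $A$-modules, indexed so that $S_{\ell+1}=\epsilon$, and $[W:S_i]$ the multiplicity of $S_i$ as a composition factor of $W$. For $n=\dim V$, the McKay matrix $M_V\in\mathbb{Z}^{(\ell+1)\times(\ell+1)}$ has $(M_V)_{i,j}=[S_j\otimes V:S_i]$, $L_V:=nI_{\ell+1}-M_V$, and $\overline{L_V}\in\mathbb{Z}^{\ell\times\ell}$ is obtained from $L_V$ by deleting the row and column indexed by $\epsilon$. A real square matrix $Q$ with nonpositive off-diagonal entries is a nonsingular $M$-matrix if it is invertible and $Q^{-1}$ has all entries nonnegative. $V$ is rich if $[V:S_i]>0$ for all $i$, and tensor-rich if $\bigoplus_{k=0}^tV^{\otimes k}$ is rich for some positive integer $t$. The critical group: $G_0(A)$ is the Grothendieck group (relations from short exact sequences), a ring via $[W][X]=[W\otimes X]$, with augmentation $[W]\mapsto\dim W$ and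 augmentation ideal $I$; $K(V):=I/G_0(A)(n-[V])$. *)

(* Defs.v *)
From HB Require Import structures.
From mathcomp Require Import all_boot all_order all_algebra all_field.
From mathcomp Require Import mxtens.
From Stdlib Require Import ClassicalEpsilon.

Set Implicit Arguments.
Unset Strict Implicit.
Unset Printing Implicit Defensive.

Import GRing.Theory Num.Theory.
Local Open Scope ring_scope.

(* Finite-dimensional Hopf algebras, with A (x) A encoded by           *)
(* coordinates in the canonical basis [hb] of A.                       *)
Section Hopf.
Variables (F : fieldType) (A : falgType F).

Definition hdim : nat := \dim (fullv : {vspace A}).
Definition hb : hdim.-tuple A := vbasis (fullv : {vspace A}).
Definition hbe (i : 'I_hdim) : A := tnth hb i.

(* coordinates of the elementary tensor x (x) y in the basis hbe i (x) hbe j *)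
Definition tens2 (x y : A) : 'M[F]_hdim :=
  \matrix_(i, j) (coord hb i x * coord hb j y).

Definition mulT (X Y : 'M[F]_hdim) : 'M[F]_hdim :=
  \sum_(i < hdim) \sum_(j < hdim) \sum_(k < hdim) \sum_(l < hdim)
     (X i j * Y k l) *: tens2 (hbe i * hbe k) (hbe j * hbe l).

(* delta a = coordinates of the coproduct of a; eps = counit; S = antipode *)
Definition is_hopf (delta : A -> 'M[F]_hdim) (eps : A -> F) (S : A -> A) : Prop :=
  (forall (c : F) (x y : A), delta (c *: x + y) = c *: delta x + delta y) /\
  (forall (c : F) (x y : A), eps (c *: x + y) = c * eps x + eps y) /\
  (forall (c : F) (x y : A), S (c *: x + y) = c *: S x + S y) /\
  delta 1 = tens2 1 1 /\ (forall a b, delta (a * b) = mulT (delta a) (delta b)) /\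
  eps 1 = 1 /\ (forall a b, eps (a * b) = eps a * eps b) /\
  (* coassociativity: (Delta (x) id) Delta = (id (x) Delta) Delta *)
  (forall a (k l m : 'I_hdim),
      \sum_(i < hdim) delta a i m * delta (hbe i) k l
    = \sum_(j < hdim) delta a k j * delta (hbe j) l m) /\
  (forall a, \sum_(i < hdim) \sum_(j < hdim) (delta a i j * eps (hbe i)) *: hbe j = a) /\
  (forall a, \sum_(i < hdim) \sum_(j < hdim) (delta a i j * eps (hbe j)) *: hbe i = a) /\
  (forall a, \sum_(i < hdim) \sum_(j < hdim) delta a i j *: (S (hbe i) * hbe j) = eps a *: 1) /\
  (forall a, \sum_(i < hdim) \sum_(j < hdim) delta a i j *: (hbe i * S (hbe j)) = eps a *: 1).

(* Finite-dimensional left A-modules: F^n (row vectors) with a acting  *)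
(* by v |-> v *m mrep a, so that (ab).v = a.(b.v) reads                *)
(* mrep (a * b) = mrep b *m mrep a.                                    *)
Record amod := AMod { mdim : nat; mrep : A -> 'M[F]_mdim }.

Definition is_amod (W : amod) : Prop :=
  [/\ (forall (c : F) (x y : A), mrep W (c *: x + y) = c *: mrep W x + mrep W y),
      mrep W 1 = 1%:M &
      (forall a b, mrep W (a * b) = mrep W b *m mrep W a)].

Definition submod (W : amod) (U : 'M[F]_(mdim W)) : Prop :=
  forall a, (U *m mrep W a <= U)%MS.

Definition simple_mod (W : amod) : Prop :=
  [/\ is_amod W, (0 < mdim W)%N &
      forall U : 'M[F]_(mdim W), submod U -> \rank U = 0%N \/ \rank U = mdim W].

Definition iso_mod (W X : amod) : Prop :=
  exists P : 'M[F]_(mdim W, mdim X),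
    [/\ row_free P, row_full P & forall a, mrep W a *m P = P *m mrep X a].

(* S is isomorphic to the subquotient U2/U1 of W (U1 <= U2 submodules):   *)
(* an A-linear isomorphism S -> U2/U1, v |-> (v *m P) + U1.              *)
Definition factor_iso (W : amod) (U1 U2 : 'M[F]_(mdim W)) (S : amod) : Prop :=
  exists P : 'M[F]_(mdim S, mdim W),
    [/\ row_free P, \rank (P :&: U1)%MS = 0%N, (P + U1 == U2)%MS &
        forall a, (mrep S a *m P - P *m mrep W a <= U1)%MS].

Definition comp_series (W : amod) (k : nat) (U : nat -> 'M[F]_(mdim W)) : Prop :=
  [/\ \rank (U 0%N) = 0%N, (U k == 1%:M)%MS &
      forall i, (i < k)%N ->
        [/\ submod (U i), submod (U i.+1), (U i < U i.+1)%MS &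
            forall X, submod X -> (U i <= X)%MS -> (X <= U i.+1)%MS ->
              (X == U i)%MS \/ (X == U i.+1)%MS]].

Definition pbool (P : Prop) : bool :=
  if excluded_middle_informative P then true else false.

Definition comp_mult (W S : amod) (m : nat) : Prop :=
  exists k (U : nat -> 'M[F]_(mdim W)),
    @comp_series W k U /\
    m = (\sum_(i < k) pbool (factor_iso (U i) (U i.+1) S))%N.

(* [W : S] (well defined by Jordan--Hoelder) *)
Definition mult (W S : amod) : nat := epsilon (inhabits 0%N) (comp_mult W S).

Definition triv_mod (eps : A -> F) : amod := @AMod 1 (fun a => (eps a)%:M).

Definition tens_mod (delta : A -> 'M[F]_hdim) (W X : amod) : amod :=
  @AMod (mdim W * mdim X)%N
    (fun a => \sum_(i < hdim) \sum_(j < hdim)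
                delta a i j *: (mrep W (hbe i) *t mrep X (hbe j))).

Definition dsum_mod (W X : amod) : amod :=
  @AMod (mdim W + mdim X)%N (fun a => block_mx (mrep W a) 0 0 (mrep X a)).

Fixpoint tpow (delta : A -> 'M[F]_hdim) (eps : A -> F) (V : amod) (k : nat) : amod :=
  match k with
  | 0 => triv_mod eps
  | k'.+1 => tens_mod delta (tpow delta eps V k') V
  end.

Fixpoint tsum (delta : A -> 'M[F]_hdim) (eps : A -> F) (V : amod) (t : nat) : amod :=
  match t with
  | 0 => tpow delta eps V 0
  | t'.+1 => dsum_mod (tsum delta eps V t') (tpow delta eps V t)
  end.

Definition simple_classes (eps : A -> F) (l : nat) (Sm : 'I_l.+1 -> amod) : Prop :=
  [/\ forall i, simple_mod (Sm i),
      forall i j, iso_mod (Sm i) (Sm j) -> i = j,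
      forall W, simple_mod W -> exists i, iso_mod W (Sm i) &
      iso_mod (Sm ord_max) (triv_mod eps)].

Section Simples.
Variables (delta : A -> 'M[F]_hdim) (eps : A -> F) (l : nat) (Sm : 'I_l.+1 -> amod).

Definition rich (W : amod) : Prop := forall i, (0 < mult W (Sm i))%N.

Definition tensor_rich (V : amod) : Prop :=
  exists t, (0 < t)%N /\ rich (tsum delta eps V t).

Definition mckay (V : amod) : 'M[int]_l.+1 :=
  \matrix_(i, j) (mult (tens_mod delta (Sm j) V) (Sm i))%:Z.

Definition lapl (V : amod) : 'M[int]_l.+1 := ((mdim V)%:Z)%:M - mckay V.

Definition red_lapl (V : amod) : 'M[int]_l :=
  \matrix_(i, j) lapl V (lift ord_max i) (lift ord_max j).

(* Grothendieck group G_0(A) = free abelian group on the simple classes; *)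
(* coordinates of [W] are the multiplicities [W : S_i].                 *)
Definition G0 := 'cV[int]_l.+1.
Definition g0cls (W : amod) : G0 := \col_i (mult W (Sm i))%:Z.
Definition g0mul (x y : G0) : G0 :=
  \sum_(j < l.+1) \sum_(k < l.+1) (x j 0 * y k 0) *: g0cls (tens_mod delta (Sm j) (Sm k)).
Definition g0one : G0 := g0cls (triv_mod eps).
Definition g0aug (x : G0) : int := \sum_(i < l.+1) x i 0 * (mdim (Sm i))%:Z.

(* K(V) = I / G_0(A) (n - [V]) is finite: finitely many cosets *)
Definition critical_group_finite (V : amod) : Prop :=
  exists s : seq G0,
    forall x : G0, g0aug x = 0 ->
      exists2 y, y \in s &
        g0aug y = 0 /\
        exists z : G0, x - y = g0mul z ((mdim V)%:Z *: g0one - g0cls V).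

End Simples.
End Hopf.

Definition nonsing_Mmatrix (R : realFieldType) (n : nat) (Q : 'M[R]_n) : Prop :=
  [/\ forall i j, i != j -> Q i j <= 0, Q \in unitmx & forall i j, 0 <= invmx Q i j].

(* Main.v *)
(* Multiplicities are well defined and additive by Jordan-Hoelder, and
   tensoring is exact, so tensoring with V acts on classes through the McKay
   matrix. Hence the row of dimensions of the simple modules is a left null
   vector of L_V. The class p of the regular module is a positive right null
   vector, because A (x) V is isomorphic to a direct sum of dim V copies of A
   and every simple module is a quotient of A.

   The rest is linear algebra over the directed graph of the nonzero
   off-diagonal entries of L_V, where tensor-richness says that every vertex is
   reachable from the trivial module. If this holds, a minimum principle for
   x / p shows that the reduced matrix has a nonnegative inverse. If it fails,
   the unreachable vertices span a subspace stable under the reduced matrix,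
   which is then singular. A singular reduced matrix has an integral left null
   vector; extended by 0 it kills the image of L_V, is unbounded on the
   augmentation ideal, and so K(V) is infinite. A nonsingular one makes K(V) a
   group killed by its determinant. *)
Require Import Defs.
From HB Require Import structures.
From mathcomp Require Import all_boot all_order all_algebra all_field.
From mathcomp Require Import mxtens ring.
From Stdlib Require Import ClassicalEpsilon.

Set Implicit Arguments.
Unset Strict Implicit.
Unset Printing Implicit Defensive.

Import Order.TTheory GRing.Theory Num.Theory.
Local Open Scope ring_scope.

(** * Subquotients of modules *)

Section Subquotients.
Variables (F : fieldType) (A : falgType F).
Implicit Types W Q T : amod A.

(* v |-> v P induces an isomorphism from Q onto U2 / U1. *)
Definition facmap W (U1 U2 : 'M[F]_(mdim W)) Q (P : 'M[F]_(mdim Q, mdim W)) :=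
  [/\ forall m (v : 'M[F]_(m, mdim Q)), (v *m P <= U1)%MS -> v = 0,
      (P + U1 :=: U2)%MS &
      forall a, (mrep Q a *m P - P *m mrep W a <= U1)%MS].

(** Cancelling coefficient matrices of any height is easier to transport than the rank conditions of
    [factor_iso]. The coefficients [D] of [P :&: U1] over [P] vanish by such a cancellation. *)
Lemma factor_isoP W (U1 U2 : 'M[F]_(mdim W)) Q :
  factor_iso U1 U2 Q <-> exists P, facmap U1 U2 (Q := Q) P.
Proof.
split=> [[P [Pfree cap0 /eqmxP sumP eqv]] | [P [inj sumP eqv]]]; exists P.
  split=> // m v vP; apply: (row_free_inj Pfree); rewrite mul0mx.
  apply/eqP; rewrite -submx0; move/eqP: cap0; rewrite mxrank_eq0 => /eqP <-.
  by rewrite sub_capmx submxMl vP.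
split=> //; last exact/eqmxP.
  rewrite -kermx_eq0; apply/eqP; apply: inj.
  by rewrite mulmx_ker sub0mx.
have /submxP[D defD] := capmxSl P U1.
have D0 : D = 0 by apply: inj; rewrite -defD capmxSr.
by rewrite defD D0 mul0mx mxrank0.
Qed.

Lemma facmap_eqmx W (U1 U2 V1 V2 : 'M[F]_(mdim W)) Q
    (P : 'M[F]_(mdim Q, mdim W)) :
  (U1 :=: V1)%MS -> (U2 :=: V2)%MS -> facmap U1 U2 P -> facmap V1 V2 P.
Proof.
move=> e1 e2 [inj sumP eqv]; split=> [m v|| a].
- by rewrite -e1; apply: inj.
- apply: eqmx_trans e2; apply: eqmx_trans sumP.
  exact: adds_eqmx (eqmx_refl _) (eqmx_sym e1).
- by rewrite -e1.
Qed.

Lemma factor_iso_eqmx W (U1 U2 V1 V2 : 'M[F]_(mdim W)) Q :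
  (U1 :=: V1)%MS -> (U2 :=: V2)%MS -> factor_iso U1 U2 Q -> factor_iso V1 V2 Q.
Proof.
by move=> e1 e2 /factor_isoP[P Pf]; apply/factor_isoP; exists P; apply: facmap_eqmx Pf.
Qed.

Lemma facmap_sub W (U1 U2 : 'M[F]_(mdim W)) Q P :
  facmap U1 U2 (Q := Q) P -> (U1 <= U2)%MS.
Proof. by case=> _ <- _; apply: addsmxSr. Qed.

Lemma facmap_rank W (U1 U2 : 'M[F]_(mdim W)) Q P :
  facmap U1 U2 (Q := Q) P -> \rank U2 = (mdim Q + \rank U1)%N.
Proof.
case=> inj <- _; rewrite mxrank_disjoint_sum.
  congr (_ + _)%N; apply/eqP; rewrite -[_ == _]/(row_free P) -kermx_eq0.
  by apply/eqP/inj; rewrite mulmx_ker sub0mx.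
have /submxP[D defD] := capmxSl P U1.
have D0 : D = 0 by apply: inj; rewrite -defD capmxSr.
by rewrite defD D0 mul0mx.
Qed.

Lemma factor_iso_sub W (U1 U2 : 'M[F]_(mdim W)) Q :
  factor_iso U1 U2 Q -> (U1 <= U2)%MS.
Proof. by case/factor_isoP=> P; apply: facmap_sub. Qed.

Lemma factor_iso_rank W (U1 U2 : 'M[F]_(mdim W)) Q :
  factor_iso U1 U2 Q -> \rank U2 = (mdim Q + \rank U1)%N.
Proof. by case/factor_isoP=> P; apply: facmap_rank. Qed.

(** Third isomorphism theorem: [X *m P + U1] is the preimage in [U2] of the subspace [X] of [Q]. *)
Lemma facmap_comp W (U1 U2 : 'M[F]_(mdim W)) Q (P : 'M[F]_(mdim Q, mdim W))
    (X Y : 'M[F]_(mdim Q)) T (R : 'M[F]_(mdim T, mdim Q)) :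
  facmap U1 U2 P -> facmap X Y R ->
  facmap (X *m P + U1)%MS (Y *m P + U1)%MS (R *m P).
Proof.
move=> [injP sumP eqvP] [injR sumR eqvR]; split=> [m v|| a].
- case/sub_addsmxP=> -[D E] /= defv; apply: injR.
  suff /eqP : v *m R - D *m X = 0 by rewrite subr_eq0 => /eqP ->; apply: submxMl.
  apply: injP; rewrite mulmxBl -mulmxA defv.
  by rewrite -!mulmxA addrC addKr submxMl.
- rewrite addsmxA; apply: adds_eqmx => //.
  by apply: eqmx_trans (eqmx_sym (addsmxMr _ _ _)) (eqmxMr _ sumR).
- have -> : mrep T a *m (R *m P) - R *m P *m mrep W a =
      (mrep T a *m R - R *m mrep Q a) *m P
        + R *m (mrep Q a *m P - P *m mrep W a).
    by rewrite mulmxBl mulmxBr !mulmxA addrA subrK.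
  apply: addmx_sub_adds; first exact: submxMr.
  exact: submx_trans (submxMl _ _) (eqvP a).
Qed.

Lemma submod_lift W (U1 U2 : 'M[F]_(mdim W)) Q (P : 'M[F]_(mdim Q, mdim W))
    (X : 'M[F]_(mdim Q)) :
  submod U1 -> facmap U1 U2 P -> submod X -> submod (X *m P + U1)%MS.
Proof.
move=> sU1 [_ _ eqv] sX a.
rewrite addsmxMr addsmx_sub; apply/andP; split; last first.
  exact: submx_trans (sU1 a) (addsmxSr _ _).
have -> : X *m P *m mrep W a =
    X *m mrep Q a *m P - X *m (mrep Q a *m P - P *m mrep W a).
  by rewrite mulmxBr !mulmxA opprB addrC subrK.
apply: addmx_sub_adds; first exact: submxMr.
by rewrite eqmx_opp; apply: submx_trans (submxMl _ _) (eqv a).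
Qed.

Lemma submod0 W : submod (0 : 'M[F]_(mdim W)).
Proof. by move=> a; rewrite mul0mx sub0mx. Qed.

Lemma submod1 W : submod (1%:M : 'M[F]_(mdim W)).
Proof. by move=> a; apply: submx1. Qed.

Lemma submod_add W (U X : 'M[F]_(mdim W)) :
  submod U -> submod X -> submod (U + X)%MS.
Proof. by move=> sU sX a; rewrite addsmxMr addsmxS. Qed.

Lemma submod_cap W (U X : 'M[F]_(mdim W)) :
  submod U -> submod X -> submod (U :&: X)%MS.
Proof.
move=> sU sX a; rewrite sub_capmx.
rewrite (submx_trans (submxMr _ (capmxSl _ _)) (sU a)).
by rewrite (submx_trans (submxMr _ (capmxSr _ _)) (sX a)).
Qed.

(** Correspondence theorem: write [Z] as [D *m P] modulo [U1] and take the row space of [D], made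
    square by [<<D>>]. *)
Lemma facmap_preim W (U1 U2 Z : 'M[F]_(mdim W)) Q (P : 'M[F]_(mdim Q, mdim W)) :
  submod U1 -> facmap U1 U2 P -> submod Z -> (U1 <= Z)%MS -> (Z <= U2)%MS ->
  exists2 X : 'M[F]_(mdim Q), submod X & (X *m P + U1 :=: Z)%MS.
Proof.
move=> sU1 [inj sumP eqv] sZ leZ1 leZ2.
have : (Z <= P + U1)%MS by rewrite sumP.
case/sub_addsmxP=> -[D E] /= defZ.
have DZ : (D *m P <= Z)%MS.
  have -> : D *m P = Z - E *m U1 by rewrite {1}defZ addrK.
  by rewrite addmx_sub // eqmx_opp (submx_trans (submxMl _ _)).
have eqX : (D *m P + U1 :=: Z)%MS.
  apply/eqmxP/andP; split; first by rewrite addsmx_sub DZ.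
  by rewrite {1}defZ addmx_sub_adds // submxMl.
exists <<D>>%MS; last first.
  by apply: eqmx_trans eqX; apply: adds_eqmx => //; apply: eqmxMr; apply: genmxE.
move=> a; rewrite genmxE (eqmxMr _ (genmxE D)).
have : (D *m mrep Q a *m P <= D *m P + U1)%MS.
  have -> : D *m mrep Q a *m P =
     D *m P *m mrep W a + D *m (mrep Q a *m P - P *m mrep W a).
    by rewrite mulmxBr !mulmxA addrC subrK.
  rewrite addmx_sub //.
    by rewrite eqX; apply: submx_trans (sZ a); apply: submxMr.
  exact: submx_trans (submxMl _ _) (submx_trans (eqv a) (addsmxSr _ _)).
case/sub_addsmxP=> -[G H] /= defG.
suff /eqP : D *m mrep Q a - G *m D = 0.
  by rewrite subr_eq0 => /eqP ->; apply: submxMl.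
by apply: inj; rewrite mulmxBl defG -!mulmxA addrC addKr submxMl.
Qed.

(** After multiplication by [P] the module laws hold modulo [U1], because they hold in [W];
    cancelling [P] makes them exact. *)
Lemma is_amod_quot W (U1 U2 : 'M[F]_(mdim W)) Q (P : 'M[F]_(mdim Q, mdim W)) :
  is_amod W -> submod U1 -> facmap U1 U2 P -> is_amod Q.
Proof.
move=> [lin one mul] sU1 [inj _ eqv].
split=> [c x y||a b]; apply/eqP; rewrite -subr_eq0; apply/eqP/inj.
- have -> : (mrep Q (c *: x + y) - (c *: mrep Q x + mrep Q y)) *m P =
      (mrep Q (c *: x + y) *m P - P *m mrep W (c *: x + y))
      - (c *: (mrep Q x *m P - P *m mrep W x)
         + (mrep Q y *m P - P *m mrep W y)).
    rewrite lin scalerBr addrACA -opprD scalemxAl scalemxAr -!(mulmxDl, mulmxDr).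
    by rewrite opprB addrA subrK -mulmxBl.
  rewrite addmx_sub // eqmx_opp addmx_sub //.
  by apply: submx_trans (eqv x); apply: scalemx_sub.
- have := eqv 1; rewrite one mulmx1 => H.
  by rewrite mulmxBl mul1mx.
- have -> : (mrep Q (a * b) - mrep Q b *m mrep Q a) *m P =
      (mrep Q (a * b) *m P - P *m mrep W (a * b))
      - (mrep Q b *m (mrep Q a *m P - P *m mrep W a)
         + (mrep Q b *m P - P *m mrep W b) *m mrep W a).
    rewrite mul [in RHS]mulmxBr [in RHS]mulmxBl !mulmxA addrA subrK.
    by rewrite opprB addrA subrK -mulmxBl.
  rewrite addmx_sub // eqmx_opp addmx_sub //.
    by apply: submx_trans (submxMl _ _) (eqv a).
  by apply: submx_trans (sU1 a); apply: submxMr.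
Qed.

(** A complement [C] of [U1] in [U2] carries the quotient: the algebra acts as on [W], followed by
    the projection onto [C] along [U1], in coordinates on a basis of [C]. *)
Lemma factor_iso_exists W (U1 U2 : 'M[F]_(mdim W)) :
  submod U1 -> submod U2 -> (U1 <= U2)%MS ->
  exists Q, factor_iso U1 U2 Q.
Proof.
move=> sU1 sU2 le12.
pose C := (U2 :\: U1)%MS; pose P := row_base C.
have eqPC : (P :=: C)%MS by apply: eq_row_base.
have CU1 : (C :&: U1 = 0)%MS by rewrite capmx_diff.
have sumC : (C + U1 :=: U2)%MS.
  apply: eqmx_trans (addsmx_diff_cap_eq U2 U1).
  apply: adds_eqmx => //.
  by apply/eqmxP; rewrite sub_capmx le12 submx_refl capmxSr.
pose q a := P *m mrep W a *m proj_mx C U1 *m pinvmx P.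
exists (AMod q); apply/factor_isoP; exists P; split=> /= [m v vP|| a].
- apply: (row_free_inj (row_base_free C)); rewrite mul0mx.
  by apply/eqP; rewrite -submx0 -CU1 sub_capmx vP -/P andbT -eqPC submxMl.
- by apply: eqmx_trans sumC; apply: adds_eqmx.
- rewrite /q mulmxKpV ?eqPC ?proj_mx_sub //.
  have PaU2 : (P *m mrep W a <= C + U1)%MS.
    by rewrite sumC; apply: submx_trans (sU2 a); apply: submxMr; rewrite eqPC diffmxSl.
  by rewrite -opprB eqmx_opp proj_mx_compl_sub.
Qed.

(** Modulo [U1] the rows of [P] and [P'] span the same space, so [P = X *m P' + E *m U1], and the
    transition matrix [X] is the isomorphism. *)
Lemma factor_iso_uniq W (U1 U2 : 'M[F]_(mdim W)) Q Q' :
  submod U1 -> factor_iso U1 U2 Q -> factor_iso U1 U2 Q' -> iso_mod Q Q'.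
Proof.
move=> sU1; case/factor_isoP=> P Pf; case/factor_isoP=> P' Pf'.
have eqdim : mdim Q = mdim Q'.
  by have := facmap_rank Pf; rewrite (facmap_rank Pf') => /addIn.
have [inj sumP eqv] := Pf; have [inj' sumP' eqv'] := Pf'.
have : (P <= P' + U1)%MS by rewrite sumP' -sumP addsmxSl.
case/sub_addsmxP=> -[X E] /= defP; exists X.
have Xfree : row_free X.
  rewrite -kermx_eq0; apply/eqP/inj.
  by rewrite defP mulmxDr mulmxA mulmx_ker mul0mx add0r mulmxA submxMl.
split=> //; first by rewrite /row_full (eqP Xfree) eqdim.
move=> a; apply/eqP; rewrite -subr_eq0; apply/eqP/inj'.
have -> : (mrep Q a *m X - X *m mrep Q' a) *m P' =
    (mrep Q a *m P - P *m mrep W a) - X *m (mrep Q' a *m P' - P' *m mrep W a)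
     - (mrep Q a *m (E *m U1) - E *m U1 *m mrep W a).
  have -> : E *m U1 = P - X *m P' by rewrite defP addrAC subrr add0r.
  have shuffle (a1 b c d e : 'M[F]_(mdim Q, mdim W)) :
      e - c = a1 - b - (c - d) - (a1 - e - (b - d)).
    have -> : a1 - e - (b - d) = a1 - b - (e - d) by rewrite !opprD !opprK addrACA.
    by rewrite addrAC subKr opprB addrA subrK.
  by rewrite mulmxBl 2!mulmxBr mulmxBl !mulmxA; apply: shuffle.
rewrite addmx_sub // ?eqmx_opp.
  rewrite addmx_sub // eqmx_opp.
  exact: submx_trans (submxMl _ _) (eqv' a).
rewrite addmx_sub //; first by rewrite mulmxA submxMl.
rewrite eqmx_opp -mulmxA; apply: submx_trans (submxMl _ _) (sU1 a).
Qed.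

End Subquotients.

(** * Simple subquotients and the second isomorphism theorem *)

Section Isomorphisms.
Variables (F : fieldType) (A : falgType F).
Implicit Types W Q T : amod A.

Lemma iso_mod_sym W Q : iso_mod W Q -> iso_mod Q W.
Proof.
case=> R [Rfree Rfull eqv]; have RV := mulmxVp Rfree; have VR := mulVpmx Rfull.
exists (pinvmx R); split=> [||a].
- by rewrite -row_leq_rank -{1}(mxrank1 F (mdim Q)) -VR mxrankM_maxl.
- by rewrite -col_leq_rank -{1}(mxrank1 F (mdim W)) -RV mxrankM_maxr.
- have -> : mrep W a = mrep W a *m R *m pinvmx R by rewrite -mulmxA RV mulmx1.
  by rewrite eqv !mulmxA VR mul1mx.
Qed.

Lemma iso_factor W Q : iso_mod Q W -> factor_iso (0 : 'M[F]_(mdim W)) 1%:M Q.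
Proof.
case=> R [Rfree Rfull eqv]; exists R; split=> // [||a].
- by rewrite capmx0 mxrank0.
- apply/eqmxP; apply: eqmx_trans (addsmx0 _ _) _.
  by apply/eqmxP; rewrite submx1 sub1mx.
- by rewrite eqv subrr sub0mx.
Qed.

Lemma factor_iso_trans W (U1 U2 : 'M[F]_(mdim W)) Q T :
  factor_iso U1 U2 Q -> iso_mod T Q -> factor_iso U1 U2 T.
Proof.
case/factor_isoP=> P Pf /iso_factor /factor_isoP[R Rf].
apply/factor_isoP; exists (R *m P); apply: facmap_eqmx (facmap_comp Pf Rf).
  by rewrite mul0mx; apply: adds0mx.
by rewrite mul1mx; case: Pf.
Qed.

(** Submodules of [Q] lift to submodules between [U1] and [U2], where maximality of the step leaves
    only the two ends. *)
Lemma simple_quot W (U1 U2 : 'M[F]_(mdim W)) Q :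
  is_amod W -> submod U1 -> (U1 < U2)%MS ->
  (forall Z, submod Z -> (U1 <= Z)%MS -> (Z <= U2)%MS ->
     (Z == U1)%MS \/ (Z == U2)%MS) ->
  factor_iso U1 U2 Q -> simple_mod Q.
Proof.
move=> mW sU1 lt12 maxi /factor_isoP[P Pf].
have rk := facmap_rank Pf; have [inj sumP eqv] := Pf.
split; first exact: is_amod_quot mW sU1 Pf.
  by rewrite -(ltn_add2r (\rank U1)) -rk rank_ltmx.
move=> X sX.
have sZ := submod_lift sU1 Pf sX.
have XP : (X *m P + U1 <= U2)%MS by rewrite -sumP addsmxS ?submxMl.
case: (maxi _ sZ (addsmxSr _ _) XP) => /eqmxP eqZ; [left|right].
  rewrite (inj _ X) ?mxrank0 // -eqZ; exact: addsmxSl.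
have : (P <= X *m P + U1)%MS by rewrite eqZ -sumP addsmxSl.
case/sub_addsmxP=> -[D E] /= defP.
have : 1%:M - D *m X = 0.
  by apply: inj; rewrite mulmxBl mul1mx {1}defP mulmxA addrAC subrr add0r submxMl.
move/eqP; rewrite subr_eq0 => /eqP D1; apply/eqP.
by rewrite eqn_leq rank_leq_row -{1}(mxrank1 F (mdim Q)) D1 mxrankM_maxr.
Qed.

(** Converse of [simple_quot], through the correspondence theorem. *)
Lemma simple_factor_max W (U1 U2 Z : 'M[F]_(mdim W)) Q :
  submod U1 -> simple_mod Q -> factor_iso U1 U2 Q ->
  submod Z -> (U1 <= Z)%MS -> (Z <= U2)%MS ->
  (Z == U1)%MS \/ (Z == U2)%MS.
Proof.
move=> sU1 [_ _ simQ] /factor_isoP[P Pf] sZ le1 le2.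
have [X sX eqX] := facmap_preim sU1 Pf sZ le1 le2.
have [inj sumP _] := Pf.
case: (simQ X sX) => rX; [left|right]; apply/eqmxP.
  move/eqP: rX; rewrite mxrank_eq0 => /eqP X0; apply: eqmx_trans (eqmx_sym eqX) _.
  by rewrite X0 mul0mx; apply: adds0mx.
apply: eqmx_trans (eqmx_sym eqX) (eqmx_trans _ sumP); apply: adds_eqmx => //.
apply/eqmxP; rewrite submxMl /=.
have /submxP[D D1] : (1%:M <= X)%MS by rewrite sub1mx /row_full rX.
by rewrite -[X in (X <= _)%MS]mul1mx D1 -mulmxA submxMl.
Qed.

Lemma simple_factor_lt W (U1 U2 : 'M[F]_(mdim W)) Q :
  simple_mod Q -> factor_iso U1 U2 Q -> (U1 < U2)%MS.
Proof.
move=> [_ posQ _] f; rewrite ltmxErank (factor_iso_sub f) (factor_iso_rank f).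
by rewrite -{1}[\rank U1]add0n ltn_add2r.
Qed.

(** Second isomorphism theorem: [D *m X], the part of [P] in [X], differs from [P] by rows in [Y]
    and so represents the same classes. *)
Lemma factor_iso_second W (X Y : 'M[F]_(mdim W)) Q :
  submod X -> submod Y ->
  factor_iso Y (X + Y)%MS Q -> factor_iso (X :&: Y)%MS X Q.
Proof.
move=> sX sY /factor_isoP[P Pf]; have rk := facmap_rank Pf.
have [inj sumP eqv] := Pf.
have : (P <= X + Y)%MS by rewrite -sumP addsmxSl.
case/sub_addsmxP=> -[D E] /= defP.
have injD m (v : 'M_(m, _)) : (v *m (D *m X) <= X :&: Y)%MS -> v = 0.
  rewrite sub_capmx => /andP[_ vY]; apply: inj.
  by rewrite defP mulmxDr addmx_sub // mulmxA submxMl.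
have eqvD a : (mrep Q a *m (D *m X) - D *m X *m mrep W a <= X :&: Y)%MS.
  rewrite sub_capmx; apply/andP; split.
    rewrite addmx_sub //; first by rewrite mulmxA submxMl.
    by rewrite eqmx_opp -mulmxA; apply: submx_trans (submxMl _ _) (sX a).
  have -> : mrep Q a *m (D *m X) - D *m X *m mrep W a =
     (mrep Q a *m P - P *m mrep W a) - (mrep Q a *m (E *m Y) - E *m Y *m mrep W a).
    apply/esym/eqP; rewrite {1 2}defP mulmxDr mulmxDl subr_eq.
    by rewrite opprD addrACA.
  rewrite addmx_sub // eqmx_opp addmx_sub //; first by rewrite mulmxA submxMl.
  by rewrite eqmx_opp -mulmxA; apply: submx_trans (submxMl _ _) (sY a).
apply/factor_isoP; exists (D *m X); split=> //.
apply/eqmxP; rewrite addsmx_sub submxMl capmxSl /=.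
have DX : (D *m X + (X :&: Y) <= X)%MS by rewrite addsmx_sub submxMl capmxSl.
(* Equality with [X] follows from the inclusion by comparing ranks. *)
have [_ <-] := mxrank_leqif_sup DX.
have := @facmap_rank _ _ W (X :&: Y)%MS (D *m X + X :&: Y)%MS Q (D *m X) _.
move=> -> //; rewrite -(eqn_add2r (\rank Y)) -addnA.
by have := mxrank_sum_cap X Y; rewrite rk => <-; rewrite addnAC addnA.
Qed.

End Isomorphisms.

(** * Composition series and the Jordan-Hoelder theorem *)

Section Chains.
Variables (F : fieldType) (A : falgType F) (l : nat) (Sm : 'I_l.+1 -> amod A).
Hypothesis Sm_simple : forall i, simple_mod (Sm i).
Hypothesis Sm_inj : forall i j, iso_mod (Sm i) (Sm j) -> i = j.
Hypothesis Sm_all : forall W, simple_mod W -> exists i, iso_mod W (Sm i).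
Implicit Types (W Q T : amod A) (s t : seq 'I_l.+1).

(* [s] lists the composition factors of [Y / X], topmost first. *)
Fixpoint chain W (X Y : 'M[F]_(mdim W)) s : Prop :=
  if s is i :: s' then
    exists Z, [/\ submod Z, chain X Z s' & factor_iso Z Y (Sm i)]
  else (X :=: Y)%MS.

Lemma chain_eqmx W (X X' Y Y' : 'M[F]_(mdim W)) s :
  (X :=: X')%MS -> (Y :=: Y')%MS -> chain X Y s -> chain X' Y' s.
Proof.
elim: s Y Y' => [|i s IH] Y Y' eX eY /=.
  by move=> e; apply: eqmx_trans (eqmx_sym eX) (eqmx_trans e eY).
case=> Z [sZ cZ fZ]; exists Z; split=> //; first exact: IH cZ.
exact: factor_iso_eqmx fZ.
Qed.

Lemma chain_cat W (X Y Z : 'M[F]_(mdim W)) s t :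
  chain X Y s -> chain Y Z t -> chain X Z (t ++ s).
Proof.
elim: t Z => [|i t IH] Z /= cXY; first by move=> eYZ; apply: chain_eqmx eYZ cXY.
by case=> T [sT cT fT]; exists T; split=> //; apply: IH.
Qed.

Lemma chain_lift W (U1 U2 : 'M[F]_(mdim W)) Q (P : 'M[F]_(mdim Q, mdim W))
    (X Y : 'M[F]_(mdim Q)) s :
  submod U1 -> facmap U1 U2 P -> chain X Y s ->
  chain (X *m P + U1)%MS (Y *m P + U1)%MS s.
Proof.
move=> sU1 Pf; elim: s Y => [|i s IH] Y /=.
  by move=> e; apply: (adds_eqmx (eqmxMr P e) (eqmx_refl U1)).
case=> Z [sZ cZ /factor_isoP[R Rf]]; exists (Z *m P + U1)%MS; split.
- exact: submod_lift Pf sZ.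
- exact: IH.
- by apply/factor_isoP; exists (R *m P); exact: facmap_comp Pf Rf.
Qed.

Definition full_chain W s := chain (0 : 'M[F]_(mdim W)) 1%:M s.

Lemma chain_factor W (U1 U2 : 'M[F]_(mdim W)) Q s :
  submod U1 -> factor_iso U1 U2 Q -> full_chain Q s -> chain U1 U2 s.
Proof.
move=> sU1 /factor_isoP[P Pf] /(chain_lift sU1 Pf); apply: chain_eqmx.
  by rewrite mul0mx; apply: adds0mx.
by rewrite mul1mx; case: Pf.
Qed.

Lemma chain_rank W (X Y : 'M[F]_(mdim W)) s :
  chain X Y s -> \rank Y = (\sum_(i <- s) mdim (Sm i) + \rank X)%N.
Proof.
elim: s Y => [|i s IH] Y /=; first by rewrite big_nil => ->.
case=> Z [_ cZ fZ]; rewrite big_cons (factor_iso_rank fZ) (IH _ cZ).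
by rewrite addnA.
Qed.

Lemma full_chain_dim W s :
  full_chain W s -> mdim W = (\sum_(i <- s) mdim (Sm i))%N.
Proof. by move/chain_rank; rewrite mxrank1 mxrank0 addn0. Qed.

(** Induction on the rank gap: cut at an intermediate submodule if there is one; otherwise the
    quotient is simple, hence isomorphic to some [Sm i]. *)
Lemma chain_exists W (X Y : 'M[F]_(mdim W)) :
  is_amod W -> submod X -> submod Y -> (X <= Y)%MS -> exists s, chain X Y s.
Proof.
move=> mW; have [n] := ubnP (\rank Y - \rank X).
elim: n X Y => // n IH X Y ltn sX sY leXY.
have [leYX|nYX] := boolP (Y <= X)%MS.
  by exists [::]; apply/eqmxP; rewrite leXY.
have ltXY : (X < Y)%MS by rewrite /ltmx leXY.
have [[Z [sZ ltXZ ltZY]]|noZ] := excluded_middle_informative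
    (exists Z, [/\ submod Z, (X < Z)%MS & (Z < Y)%MS]).
  rewrite ltnS in ltn; have rXZ := rank_ltmx ltXZ; have rZY := rank_ltmx ltZY.
  have [|s cs] := IH X Z _ sX sZ (ltmxW ltXZ).
    apply: leq_trans ltn; rewrite ltn_sub2r //.
    exact: ltn_trans rXZ rZY.
  have [|t ct] := IH Z Y _ sZ sY (ltmxW ltZY).
    by apply: leq_trans ltn; rewrite ltn_sub2l // (ltn_trans rXZ).
  by exists (t ++ s); apply: chain_cat ct.
have [Q fQ] := factor_iso_exists sX sY leXY.
have simQ : simple_mod Q.
  apply: simple_quot mW sX ltXY _ fQ => Z sZ leXZ leZY.
  have [leZX|nZX] := boolP (Z <= X)%MS; first by left; apply/andP.
  have [leYZ|nYZ] := boolP (Y <= Z)%MS; first by right; apply/andP.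
  by case: noZ; exists Z; rewrite /ltmx leXZ leZY nZX nYZ.
have [i iQ] := Sm_all simQ.
exists [:: i] => /=; exists X; split=> //.
by apply: factor_iso_trans fQ _; apply: iso_mod_sym.
Qed.

Lemma chain0 W (X Y : 'M[F]_(mdim W)) s :
  submod X -> chain X Y s -> (Y <= X)%MS -> s = [::].
Proof.
case: s => // i s sX c leYX; have := chain_rank c.
rewrite big_cons => rk; have := mxrankS leYX; rewrite rk.
have [_ posi _] := Sm_simple i.
by rewrite -{2}[\rank X]add0n leq_add2r leqn0 addn_eq0 (gtn_eqF posi).
Qed.

(* Jordan-Hoelder: if the two topmost submodules Z, Z' differ, both series
   are compared with one passing through the intersection of Z and Z'. *)
Lemma chain_perm W (Y : 'M[F]_(mdim W)) s t :
  is_amod W -> submod Y -> chain 0 Y s -> chain 0 Y t -> perm_eq s t.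
Proof.
move=> mW; have [n] := ubnP (size s).
elim: n Y s t => // n IH Y [|i s] t lts sY cs ct.
  by rewrite (chain0 (submod0 _) ct) //= -cs sub0mx.
case: t ct => [|j t] ct.
  by have := chain0 (submod0 _) cs; rewrite -ct sub0mx => /(_ isT).
have [Z [sZ cZ fZ]] := cs; have [Z' [sZ' cZ' fZ']] := ct.
have leZ := factor_iso_sub fZ; have leZ' := factor_iso_sub fZ'.
have maxZ := simple_factor_max sZ (Sm_simple i) fZ.
have maxZ' := simple_factor_max sZ' (Sm_simple j) fZ'.
have ltZ := simple_factor_lt (Sm_simple i) fZ.
have ltZ' := simple_factor_lt (Sm_simple j) fZ'.
have leS : (Z + Z' <= Y)%MS by rewrite addsmx_sub leZ.
have sS := submod_add sZ sZ'.
case: (maxZ _ sS (addsmxSl _ _) leS) => [/andP[leSZ _]|/eqmxP eqS].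
  have leZ'Z : (Z' <= Z)%MS by apply: submx_trans (addsmxSr _ _) leSZ.
  have eqZ : (Z :=: Z')%MS.
    case: (maxZ' _ sZ leZ'Z leZ) => /eqmxP // eZ.
    by have /andP[_ /negP[]] := ltZ; rewrite eZ submx_refl.
  have <- : i = j.
    apply: Sm_inj; apply: factor_iso_uniq sZ' _ fZ'.
    exact: factor_iso_eqmx fZ.
  rewrite perm_cons; apply: IH cZ _ => //.
  by apply: chain_eqmx cZ'; last exact: eqmx_sym.
have sD := submod_cap sZ sZ'.
have [u cu] := chain_exists mW (submod0 W) sD (sub0mx _ _).
have cju : chain 0 Z (j :: u).
  exists (Z :&: Z')%MS; split=> //; apply: factor_iso_second => //.
  by apply: factor_iso_eqmx fZ'; last exact: eqmx_sym.
have ciu : chain 0 Z' (i :: u).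
  exists (Z :&: Z')%MS; split=> //; rewrite capmxC; apply: factor_iso_second => //.
  by rewrite addsmxC; apply: factor_iso_eqmx fZ; last exact: eqmx_sym.
have p1 := IH _ _ _ lts sZ cZ cju.
have lu : (size (i :: u) < n)%N by move/perm_size: p1 lts => /= ->.
have p2 := IH _ _ _ lu sZ' ciu cZ'.
apply: (@perm_trans _ [:: i, j & u]); first by rewrite perm_cons.
apply: (@perm_trans _ [:: j, i & u]); last by rewrite perm_cons.
exact/permPl/(perm_catCA [:: i] [:: j] u).
Qed.

(** * Multiplicities as counts in chains *)

Lemma pboolP (P : Prop) : reflect P (pbool P).
Proof. by rewrite /pbool; case: excluded_middle_informative => H; constructor. Qed.

(** Each step has a simple quotient, isomorphic to exactly one [Sm i], so testing every step against
    [Sm j] counts the label [j]. *)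
Lemma comp_series_chain W k (U : nat -> 'M[F]_(mdim W)) :
  is_amod W -> comp_series k U ->
  exists2 s, full_chain W s & forall j,
    (\sum_(i < k) pbool (factor_iso (U i) (U i.+1) (Sm j)))%N = count_mem j s.
Proof.
move=> mW [U0 /eqmxP Uk step].
have /eqP U00 : U 0%N == 0 by rewrite -mxrank_eq0 U0.
suff /(_ k (leqnn k)) [s cs ds] : forall m, (m <= k)%N ->
    exists2 s, chain 0 (U m) s & forall j,
     (\sum_(i < m) pbool (factor_iso (U i) (U i.+1) (Sm j)))%N = count_mem j s.
  by exists s => //; apply: chain_eqmx cs.
elim=> [|m IH] lem; first by exists [::] => [|j] /=; rewrite ?U00 ?big_ord0.
have [s cs ds] := IH (ltnW lem).
have [sU sU' ltU maxU] := step m lem.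
have [Q fQ] := factor_iso_exists sU sU' (ltmxW ltU).
have [i iQ] := Sm_all (simple_quot mW sU ltU maxU fQ).
have fi := factor_iso_trans fQ (iso_mod_sym iQ).
exists (i :: s); first by exists (U m).
move=> j; rewrite big_ord_recr /= ds addnC; congr (_ + _)%N.
apply: congr1; apply/pboolP/eqP => [fj|<-] //.
by apply: Sm_inj; apply: factor_iso_uniq sU fi fj.
Qed.

Lemma comp_series_exists W :
  is_amod W -> exists k (U : nat -> 'M[F]_(mdim W)), comp_series k U.
Proof.
move=> mW; have [s] := chain_exists mW (submod0 W) (submod1 W) (submx1 _).
suff H (Y : 'M[F]_(mdim W)) : submod Y -> chain 0 Y s ->
    exists U : nat -> 'M[F]_(mdim W),
    [/\ \rank (U 0%N) = 0%N, U (size s) = Y &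
      forall i, (i < size s)%N ->
        [/\ submod (U i), submod (U i.+1), (U i < U i.+1)%MS &
            forall X, submod X -> (U i <= X)%MS -> (X <= U i.+1)%MS ->
              (X == U i)%MS \/ (X == U i.+1)%MS]].
  case/(H _ (submod1 W))=> U [U0 Us step]; exists (size s), U; split=> //.
  by rewrite Us; apply/eqmxP.
elim: s Y => [|i s IH] Y sY /=.
  by move=> e; exists (fun=> Y); split=> //; rewrite -e mxrank0.
case=> Z [sZ cZ fZ]; have [U [U0 Us step]] := IH Z sZ cZ.
exists (fun m => if (m <= size s)%N then U m else Y); split=> //=.
  by rewrite ltnn.
move=> m; rewrite ltnS => lem; rewrite lem.
case: ltnP => [lt|ge]; first exact: step.
have -> : m = size s by apply/eqP; rewrite eqn_leq lem.
rewrite Us; split=> //; first exact: simple_factor_lt fZ.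
by move=> X; apply: simple_factor_max fZ.
Qed.

(** Existence of a composition series gives [epsilon] a value to pick, and Jordan-Hoelder makes the
    pick independent of the series. *)
Lemma mult_chain W s i :
  is_amod W -> full_chain W s -> mult W (Sm i) = count_mem i s.
Proof.
move=> mW cs; have [k [U cU]] := comp_series_exists mW.
have : comp_mult W (Sm i) (mult W (Sm i)).
  by apply: epsilon_spec; eexists; exists k, U.
case=> k' [U' [cU' ->]]; have [t ct ->] := comp_series_chain mW cU'.
by have /permP := chain_perm mW (submod1 W) ct cs; apply.
Qed.

Lemma full_chain_exists W : is_amod W -> exists s, full_chain W s.
Proof.
move=> mW; apply: chain_exists => //; first exact: submod0.
  exact: submod1.
exact: submx1.
Qed.

Lemma dim_mult W :
  is_amod W -> mdim W = (\sum_i mult W (Sm i) * mdim (Sm i))%N.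
Proof.
move=> mW; have [s cs] := full_chain_exists mW.
rewrite (full_chain_dim cs) (partition_big id xpredT) //=.
apply: eq_bigr => i _; rewrite (mult_chain i mW cs).
rewrite (eq_bigr (fun=> mdim (Sm i))) => [|j /eqP-> //].
by rewrite big_const_seq iter_addn_0 mulnC.
Qed.

Lemma mult_iso W Q i :
  is_amod W -> is_amod Q -> iso_mod W Q -> mult W (Sm i) = mult Q (Sm i).
Proof.
move=> mW mQ iWQ; have [s cs] := full_chain_exists mW.
rewrite (mult_chain i mW cs) (mult_chain (W := Q) (s := s)) //.
by apply: chain_factor (submod0 _) (iso_factor iWQ) cs.
Qed.

End Chains.

(** * Tensor products, the regular module and direct sums *)

Section TensorMatrices.
Variable F : fieldType.

Lemma tensmxDl m n p q (B C : 'M[F]_(m, n)) (D : 'M[F]_(p, q)) :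
  (B + C) *t D = B *t D + C *t D.
Proof. by apply/matrixP=> i j; rewrite !mxE mulrDl. Qed.

Lemma tensmxDr m n p q (B : 'M[F]_(m, n)) (C D : 'M[F]_(p, q)) :
  B *t (C + D) = B *t C + B *t D.
Proof. by apply/matrixP=> i j; rewrite !mxE mulrDr. Qed.

Lemma tensmxZl m n p q a (B : 'M[F]_(m, n)) (D : 'M[F]_(p, q)) :
  (a *: B) *t D = a *: (B *t D).
Proof. by apply/matrixP=> i j; rewrite !mxE mulrA. Qed.

Lemma tensmxZr m n p q a (B : 'M[F]_(m, n)) (D : 'M[F]_(p, q)) :
  B *t (a *: D) = a *: (B *t D).
Proof. by apply/matrixP=> i j; rewrite !mxE mulrCA. Qed.

Lemma tensmxBl m n p q (B C : 'M[F]_(m, n)) (D : 'M[F]_(p, q)) :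
  (B - C) *t D = B *t D - C *t D.
Proof. by rewrite tensmxDl -scaleN1r tensmxZl scaleN1r. Qed.

Lemma tensmxBr m n p q (B : 'M[F]_(m, n)) (C D : 'M[F]_(p, q)) :
  B *t (C - D) = B *t C - B *t D.
Proof. by rewrite tensmxDr -scaleN1r tensmxZr scaleN1r. Qed.

Lemma tensmx_suml m n p q (I : finType) (B : I -> 'M[F]_(m, n)) (D : 'M[F]_(p, q)) :
  (\sum_i B i) *t D = \sum_i B i *t D.
Proof.
apply: (big_morph (fun B => B *t D)) => [x y|]; last exact: tens0mx.
exact: tensmxDl.
Qed.

Lemma tensmx_sumr m n p q (I : finType) (B : 'M[F]_(m, n)) (D : I -> 'M[F]_(p, q)) :
  B *t (\sum_i D i) = \sum_i B *t D i.
Proof.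
apply: (big_morph (fun D => B *t D)) => [x y|]; last exact: tensmx0.
exact: tensmxDr.
Qed.

Lemma tensmx1 m n : (1%:M : 'M[F]_m) *t (1%:M : 'M[F]_n) = 1%:M.
Proof.
apply/matrixP=> i j; case: (mxtens_indexP i) => i1 i2; case: (mxtens_indexP j) => j1 j2.
rewrite tensmxE !mxE -natrM mulnb; congr (nat_of_bool _)%:R.
apply/andP/eqP=> [[/eqP-> /eqP->] //|].
by move=> e; have [-> ->] := can_inj (@mxtens_indexK m n) e.
Qed.

Lemma submx_tensl m1 m2 n k (U : 'M[F]_(m1, n)) (V : 'M[F]_(m2, n)) (B : 'M[F]_k) :
  (U <= V)%MS -> (U *t B <= V *t 1%:M)%MS.
Proof.
case/submxP=> D ->; apply/submxP; exists (D *t B).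
by rewrite tensmx_mul mulmx1.
Qed.

Lemma submx_tensr m1 m2 n k (U : 'M[F]_(m1, n)) (V : 'M[F]_(m2, n)) (B : 'M[F]_k) :
  (U <= V)%MS -> (B *t U <= 1%:M *t V)%MS.
Proof.
case/submxP=> D ->; apply/submxP; exists (B *t D).
by rewrite tensmx_mul mulmx1.
Qed.

(** The matrices [delta_mx 0 i *t 1%:M] cut out the row blocks, which determine the whole matrix. *)
Lemma tensmx_row_inj m n k (B C : 'M[F]_(m * n, k)) :
  (forall i, (delta_mx (0 : 'I_1) i *t 1%:M) *m B = (delta_mx 0 i *t 1%:M) *m C) ->
  B = C.
Proof.
move=> H; rewrite -[B]mul1mx -[C]mul1mx -tensmx1 mx1_sum_delta tensmx_suml.
rewrite !mulmx_suml; apply: eq_bigr => i _; rewrite -(mul_delta_mx (0 : 'I_1)).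
by rewrite -[1%:M]mulmx1 -tensmx_mul -!mulmxA H.
Qed.

End TensorMatrices.

(** * Exactness of the tensor product *)

Section TensorExactness.
Variables (F : fieldType) (A : falgType F) (delta : A -> 'M[F]_(hdim A)).
Implicit Types W X Q : amod A.

(** Over a field the parametrisation of a subquotient splits linearly. The two equations for [G]
    pass to tensor products at once, which is how injectivity survives tensoring. *)
Lemma facmap_retract W (U1 U2 : 'M[F]_(mdim W)) Q (P : 'M[F]_(mdim Q, mdim W)) :
  facmap U1 U2 P -> exists2 G, P *m G = 1%:M & U1 *m G = 0.
Proof.
case=> inj _ _; pose K := cokermx U1.
have PKfree : row_free (P *m K).
  rewrite -kermx_eq0; apply/eqP/inj.
  by rewrite submxE -mulmxA mulmx_ker.
exists (K *m pinvmx (P *m K)); first by rewrite mulmxA mulmxVp.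
by rewrite mulmxA mulmx_coker mul0mx.
Qed.

Local Notation "W (x) X" := (tens_mod delta W X) (at level 40).

Lemma factor_tensl W X Q (U1 U2 : 'M[F]_(mdim W)) :
  factor_iso U1 U2 Q ->
  @factor_iso _ _ (W (x) X) (U1 *t 1%:M) (U2 *t 1%:M) (Q (x) X).
Proof.
case/factor_isoP=> P Pf; have [G PG UG] := facmap_retract Pf.
have [inj sumP eqv] := Pf.
apply/factor_isoP; exists (P *t 1%:M); split=> [m v|| a].
- case/submxP=> D defD.
  rewrite -[v]mulmx1 -[1%:M]tensmx1 -PG -[X in _ *t X]mulmx1 -tensmx_mul mulmxA.
  by rewrite defD -mulmxA tensmx_mul UG tens0mx mulmx0.
- apply/eqmxP/andP; split.
    by rewrite addsmx_sub !submx_tensl // -sumP ?addsmxSl ?addsmxSr.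
  have : (U2 <= P + U1)%MS by rewrite sumP.
  case/sub_addsmxP=> -[D E] /= ->; rewrite tensmxDl.
  by rewrite addmx_sub_adds // submx_tensl // submxMl.
- rewrite /= mulmx_suml mulmx_sumr -sumrB summx_sub // => i _.
  rewrite mulmx_suml mulmx_sumr -sumrB summx_sub // => j _.
  rewrite -scalemxAl -scalemxAr -scalerBr scalemx_sub // !tensmx_mul.
  by rewrite mul1mx mulmx1 -tensmxBl submx_tensl.
Qed.

Lemma factor_tensr W X Q (U1 U2 : 'M[F]_(mdim W)) :
  factor_iso U1 U2 Q ->
  @factor_iso _ _ (X (x) W) (1%:M *t U1) (1%:M *t U2) (X (x) Q).
Proof.
case/factor_isoP=> P Pf; have [G PG UG] := facmap_retract Pf.
have [inj sumP eqv] := Pf.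
apply/factor_isoP; exists (1%:M *t P); split=> [m v|| a].
- case/submxP=> D defD.
  rewrite -[v]mulmx1 -[1%:M]tensmx1 -PG -[X in X *t _]mulmx1 -tensmx_mul mulmxA.
  by rewrite defD -mulmxA tensmx_mul UG tensmx0 mulmx0.
- apply/eqmxP/andP; split.
    by rewrite addsmx_sub !submx_tensr // -sumP ?addsmxSl ?addsmxSr.
  have : (U2 <= P + U1)%MS by rewrite sumP.
  case/sub_addsmxP=> -[D E] /= ->; rewrite tensmxDr.
  by rewrite addmx_sub_adds // submx_tensr // submxMl.
- rewrite /= mulmx_suml mulmx_sumr -sumrB summx_sub // => i _.
  rewrite mulmx_suml mulmx_sumr -sumrB summx_sub // => j _.
  rewrite -scalemxAl -scalemxAr -scalerBr scalemx_sub // !tensmx_mul.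
  by rewrite mul1mx mulmx1 -tensmxBr submx_tensr.
Qed.

Lemma submod_tensl W X (U : 'M[F]_(mdim W)) :
  submod U -> @submod _ _ (W (x) X) (U *t 1%:M).
Proof.
move=> sU a; rewrite /= mulmx_sumr summx_sub // => i _.
rewrite mulmx_sumr summx_sub // => j _.
by rewrite -scalemxAr scalemx_sub // tensmx_mul submx_tensl.
Qed.

Lemma submod_tensr W X (U : 'M[F]_(mdim W)) :
  submod U -> @submod _ _ (X (x) W) (1%:M *t U).
Proof.
move=> sU a; rewrite /= mulmx_sumr summx_sub // => i _.
rewrite mulmx_sumr summx_sub // => j _.
by rewrite -scalemxAr scalemx_sub // tensmx_mul submx_tensr.
Qed.

End TensorExactness.

(** * Modules over a Hopf algebra *)

Section HopfModules.
Variables (F : fieldType) (A : falgType F).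
Variables (delta : A -> 'M[F]_(hdim A)) (eps : A -> F) (S : A -> A).
Hypothesis hopf : is_hopf delta eps S.
Implicit Types W X Q : amod A.
Local Notation hb := (hb A).
Local Notation "W (x) X" := (tens_mod delta W X) (at level 40).

Lemma hb_coord (x : A) : x = \sum_i coord hb i x *: hbe i.
Proof.
rewrite [LHS](coord_vbasis (memvf x)); apply: eq_bigr => i _.
by rewrite /hbe (tnth_nth 0).
Qed.

Lemma coord_hbe i j : coord hb i (hbe j) = (i == j)%:R.
Proof. by rewrite /hbe (tnth_nth 0) coord_free ?(basis_free (vbasisP _)) // eq_sym. Qed.

Lemma linear_comb (V : lmodType F) (f : A -> V) :
  (forall (c : F) x y, f (c *: x + y) = c *: f x + f y) ->
  forall (I : finType) (c : I -> F) (x : I -> A),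
    f (\sum_i c i *: x i) = \sum_i c i *: f (x i).
Proof.
move=> lin I c x; have f0 : f 0 = 0.
  by have := lin 1 0 0; rewrite !scale1r addr0 => /eqP; rewrite -subr_eq subrr => /eqP.
by elim/big_rec2: _ => // i u v _ <-; rewrite lin.
Qed.

Lemma linear_comb2 (V : lmodType F) (f : A -> V) :
  (forall (c : F) x y, f (c *: x + y) = c *: f x + f y) ->
  forall (I J : finType) (c : I -> J -> F) (x : I -> J -> A),
    f (\sum_i \sum_j c i j *: x i j) = \sum_i \sum_j c i j *: f (x i j).
Proof.
move=> lin I J c x; rewrite !pair_big /=.
exact: (linear_comb lin (fun p => c p.1 p.2) (fun p => x p.1 p.2)).
Qed.

Lemma mrepE W x : is_amod W -> mrep W x = \sum_i coord hb i x *: mrep W (hbe i).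
Proof. by case=> lin _ _; rewrite {1}(hb_coord x) linear_comb. Qed.

(** Action of an arbitrary element of A (x) A on W (x) X. [tens_mod] uses its value at [delta a];
    the module laws are checked on elementary tensors and extended linearly. *)
Definition tact W X (M : 'M[F]_(hdim A)) :=
  \sum_i \sum_j M i j *: (mrep W (hbe i) *t mrep X (hbe j)).

Lemma tact_linear W X c (M N : 'M[F]_(hdim A)) :
  tact W X (c *: M + N) = c *: tact W X M + tact W X N.
Proof.
rewrite /tact scaler_sumr -big_split /=; apply: eq_bigr => i _.
rewrite scaler_sumr -big_split /=; apply: eq_bigr => j _.
by rewrite !mxE scalerDl scalerA.
Qed.

Lemma tact0 W X : tact W X 0 = 0.
Proof. by rewrite /tact !big1 // => i _; rewrite big1 // => j _; rewrite mxE scale0r. Qed.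

Lemma tact_sum W X (I : finType) (M : I -> 'M[F]_(hdim A)) :
  tact W X (\sum_i M i) = \sum_i tact W X (M i).
Proof.
apply: (big_morph (tact W X)) => [M1 M2|]; last exact: tact0.
by have := tact_linear W X 1 M1 M2; rewrite !scale1r.
Qed.

Lemma tactZ W X c M : tact W X (c *: M) = c *: tact W X M.
Proof. by have := tact_linear W X c M 0; rewrite tact0 !addr0. Qed.

Lemma tact_tens2 W X x y : is_amod W -> is_amod X ->
  tact W X (tens2 x y) = mrep W x *t mrep X y.
Proof.
move=> mW mX; rewrite (mrepE x mW) (mrepE y mX) tensmx_suml.
apply: eq_bigr => i _; rewrite tensmx_sumr; apply: eq_bigr => j _.
by rewrite mxE tensmxZl tensmxZr scalerA.
Qed.

Lemma is_amod_tens W X : is_amod W -> is_amod X -> is_amod (W (x) X).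
Proof.
move=> mW mX; have [lin [_ [_ [d1 [dM _]]]]] := hopf.
split=> [c x y||a b].
- by rewrite -[LHS]/(tact W X _) lin tact_linear.
- rewrite -[LHS]/(tact W X _) d1 tact_tens2 //.
  by case: mW mX => _ -> _ [_ -> _]; apply: tensmx1.
- have [_ _ mulW] := mW; have [_ _ mulX] := mX.
  rewrite -[LHS]/(tact W X _) dM /mulT tact_sum /= mulmx_sumr.
  apply: eq_bigr => i _; rewrite tact_sum mulmx_sumr; apply: eq_bigr => j _.
  rewrite tact_sum mulmx_suml; apply: eq_bigr => k _.
  rewrite tact_sum mulmx_suml; apply: eq_bigr => m _.
  rewrite tactZ tact_tens2 // mulW mulX -tensmx_mul.
  by rewrite -scalemxAl -scalemxAr scalerA mulrC.
Qed.

(** * The regular module and trivial modules *)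

Definition regular_mod : amod A :=
  @AMod _ A (hdim A) (fun a => \matrix_(i, j) coord hb j (a * hbe i)).

Lemma is_amod_regular : is_amod regular_mod.
Proof.
split=> [c x y||a b]; apply/matrixP=> i j; rewrite !mxE.
- by rewrite mulrDl -scalerAl linearP.
- by rewrite mul1r coord_hbe eq_sym.
- rewrite -mulrA {1}(hb_coord (b * hbe i)) mulr_sumr linear_sum.
  by apply: eq_bigr => k _; rewrite !mxE -scalerAr linearZ.
Qed.

(* The map a |-> v a from the regular module onto a simple module. *)
Lemma simple_regular_quot Q : simple_mod Q ->
  exists2 U : 'M[F]_(mdim regular_mod), submod U & factor_iso U 1%:M Q.
Proof.
move=> [mQ posQ simQ]; have [_ one mul] := mQ.
pose v : 'rV[F]_(mdim Q) := delta_mx 0 (Ordinal posQ).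
pose g : 'M[F]_(hdim A, mdim Q) := \matrix_(i, j) (v *m mrep Q (hbe i)) 0 j.
have rowg i : row i g = v *m mrep Q (hbe i).
  by apply/rowP=> j; rewrite !mxE; apply: eq_bigr => k _; rewrite ?mxE.
have eqg a : mrep regular_mod a *m g = g *m mrep Q a.
  apply/row_matrixP=> i; rewrite !row_mul rowg -mulmxA -mul.
  rewrite (mrepE (a * _) mQ) mulmx_sumr mulmx_sum_row.
  by apply: eq_bigr => k _; rewrite rowg -scalemxAr !mxE.
have sg : submod <<g>>%MS.
  by move=> a; rewrite genmxE (eqmxMr _ (genmxE g)) -eqg submxMl.
have vg : (v <= g)%MS.
  rewrite -[v]mulmx1 -one (mrepE 1 mQ) mulmx_sumr summx_sub // => i _.
  by rewrite -scalemxAr scalemx_sub // -rowg row_sub.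
have gfull : row_full g.
  case: (simQ _ sg); rewrite genmxE => rg; last by rewrite /row_full rg.
  by have := mxrankS vg; rewrite rg mxrank_delta.
have Vg := mulVpmx gfull.
exists (kermx g).
  move=> a; apply/sub_kermxP.
  by rewrite -mulmxA eqg mulmxA mulmx_ker mul0mx.
apply/factor_isoP; exists (pinvmx g); split=> [m w /sub_kermxP|| a].
- by rewrite -mulmxA Vg mulmx1.
- apply/eqmxP; rewrite submx1 /=.
  have -> : 1%:M = g *m pinvmx g + (1%:M - g *m pinvmx g) :> 'M[F]_(hdim A).
    by rewrite addrC subrK.
  rewrite addmx_sub_adds ?submxMl //; apply/sub_kermxP.
  by rewrite mulmxBl mul1mx -mulmxA Vg mulmx1 subrr.
- have e1 : mrep Q a *m pinvmx g *m g = mrep Q a by rewrite -mulmxA Vg mulmx1.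
  have e2 : pinvmx g *m mrep regular_mod a *m g = mrep Q a.
    by rewrite -mulmxA eqg mulmxA Vg mul1mx.
  apply/sub_kermxP; apply: etrans (mulmxBl _ _ _) _.
  by apply/eqP; rewrite subr_eq0; apply/eqP; apply: etrans e1 (esym e2).
Qed.

(** The sum of [n] copies of the trivial module. Tensoring with it gives [n] copies of a module, on
    the same space as tensoring with any module of dimension [n]. *)
Definition trivial_mod n : amod A := @AMod _ A n (fun a => (eps a)%:M).

Lemma is_amod_trivial n : is_amod (trivial_mod n).
Proof.
have [_ [lin [_ [_ [_ [e1 [eM _]]]]]]] := hopf.
split=> [c x y||a b] /=.
- by rewrite lin raddfD scale_scalar_mx.
- by rewrite e1.
- by rewrite eM mulrC scalar_mxM.
Qed.

Lemma tens_trivialE W n a : is_amod W ->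
  mrep (W (x) trivial_mod n) a = mrep W a *t 1%:M.
Proof.
move=> mW; have [_ [_ [_ [_ [_ [_ [_ [_ [_ [counit _]]]]]]]]]] := hopf.
have [lin _ _] := mW.
rewrite -[in RHS](counit a) linear_comb2 // tensmx_suml.
apply: eq_bigr => i _; rewrite tensmx_suml; apply: eq_bigr => j _ /=.
by rewrite -(scalemx1 _ (eps (hbe j))) tensmxZr tensmxZl scalerA.
Qed.

Lemma iso_cast W n (e : mdim W = n) :
  iso_mod W (AMod (fun a => castmx (e, e) (mrep W a))).
Proof.
case: _ / e; exists 1%:M; split=> [||a].
- by rewrite row_free_unit unitmx1.
- by rewrite row_full_unit unitmx1.
- by rewrite /= castmx_id mulmx1 mul1mx.
Qed.


Lemma iso_tens_trivial1 W : is_amod W -> iso_mod (W (x) triv_mod eps) W.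
Proof.
move=> mW; have [R [Rfree Rfull eqv]] := iso_cast (esym (muln1 (mdim W))).
apply: iso_mod_sym; exists R; split=> // a.
rewrite eqv -[mrep (W (x) _) a]/(mrep (W (x) trivial_mod 1) a) tens_trivialE //.
by rewrite tens_mx_scalar scale1r.
Qed.

(** * Untwisting the tensor product with the regular module *)

Definition coprod_mx k : 'M[F]_(hdim A) := \matrix_(i, j) delta (hbe i) j k.

Definition untwist_mx X : 'M[F]_(hdim A * mdim X) :=
  \sum_k coprod_mx k *t mrep X (hbe k).

(** In the row convention [coprod_mx k] sends a to a_1 weighted by coordinate k of a_2. By
    coassociativity, both sides send a to a_1 weighted by coordinate m of a_2 and coordinate k of
    a_3. *)
Lemma coprod_mx_mul k m :
  coprod_mx k *m coprod_mx m = \sum_j delta (hbe j) m k *: coprod_mx j.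
Proof.
have [_ [_ [_ [_ [_ [_ [_ [coassoc _]]]]]]]] := hopf.
apply/matrixP=> i p; rewrite !mxE summxE.
transitivity (\sum_j delta (hbe i) j k * delta (hbe j) p m).
  by apply: eq_bigr => j _; rewrite !mxE.
by rewrite coassoc; apply: eq_bigr => j _; rewrite !mxE mulrC.
Qed.

Lemma coprod_mx_counit : \sum_j eps (hbe j) *: coprod_mx j = 1%:M.
Proof.
have [_ [_ [_ [_ [_ [_ [_ [_ [_ [counit _]]]]]]]]]] := hopf.
apply/matrixP=> i p; rewrite summxE mxE eq_sym -coord_hbe -[in RHS](counit (hbe i)).
rewrite linear_sum [in RHS](bigD1 p) //= [X in _ = _ + X]big1 ?addr0 => [|q neq].
  rewrite linear_sum; apply: eq_bigr => j _.
  by rewrite linearZ /= coord_hbe eqxx mulr1 !mxE mulrC.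
rewrite linear_sum big1 // => j _.
by rewrite linearZ /= coord_hbe eq_sym (negPf neq) mulr0.
Qed.

(* a (x) v |-> a_1 (x) S(a_2) v is a one-sided inverse of
   a (x) v |-> a_1 (x) a_2 v, which is what untwist_mx represents. *)
Lemma untwist_mxV X : is_amod X ->
  (\sum_k coprod_mx k *t mrep X (S (hbe k))) *m untwist_mx X = 1%:M.
Proof.
move=> mX; have [_ [_ [_ [_ [_ [_ [_ [_ [_ [_ [_ antipode]]]]]]]]]]] := hopf.
have [lin one mul] := mX.
rewrite mulmx_suml (eq_bigr (fun k => \sum_m \sum_j
    delta (hbe j) m k *: (coprod_mx j *t mrep X (hbe m * S (hbe k))))); last first.
  move=> k _; rewrite mulmx_sumr; apply: eq_bigr => m _.
  rewrite tensmx_mul -mul coprod_mx_mul tensmx_suml.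
  by apply: eq_bigr => j _; rewrite tensmxZl.
rewrite exchange_big /=; under eq_bigr do rewrite exchange_big.
rewrite exchange_big /= -tensmx1 -coprod_mx_counit tensmx_suml.
apply: eq_bigr => j _.
rewrite tensmxZl -tensmxZr -one -(addr0 (eps _ *: _)).
have -> : eps (hbe j) *: mrep X 1 + 0 = mrep X (eps (hbe j) *: 1).
  have /= := linear_comb lin (fun=> eps (hbe j)) (fun _ : 'I_1 => 1).
  by rewrite !big_ord1 addr0.
(* The factors acting on [X] are now a_1 S(a_2) for a = [hbe j], which the antipode axiom collapses
   to the counit. *)
rewrite -antipode linear_comb2 // tensmx_sumr.
apply: eq_bigr => m _; rewrite tensmx_sumr.
by apply: eq_bigr => k _; rewrite tensmxZr.
Qed.

(** The untwisting map sends e_i (x) v to e_i . (1 (x) v), where e_i acts through the coproduct. *)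
Lemma untwist_mx_row X i : is_amod X ->
  (delta_mx 0 i *t 1%:M) *m untwist_mx X =
  ((\row_j coord hb j 1) *t 1%:M) *m mrep (regular_mod (x) X) (hbe i).
Proof.
move=> mX; transitivity
    (\sum_k \sum_j delta (hbe i) j k *: (delta_mx (0 : 'I_1) j *t mrep X (hbe k))).
  rewrite mulmx_sumr; apply: eq_bigr => k _.
  rewrite tensmx_mul mul1mx -rowE [row _ _]row_sum_delta tensmx_suml.
  by apply: eq_bigr => j _; rewrite tensmxZl !mxE.
rewrite exchange_big mulmx_sumr; apply: eq_bigr => j _.
rewrite mulmx_sumr; apply: eq_bigr => k _.
rewrite -scalemxAr tensmx_mul mul1mx; congr (_ *: (_ *t _)).
apply/rowP=> m; rewrite !mxE.
under eq_bigr do rewrite !mxE -[_ * _]linearZ scalerAr.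
by rewrite -linear_sum -mulr_sumr -hb_coord mulr1 /= coord_hbe.
Qed.

(** On e_i (x) v both sides give (a e_i) . (1 (x) v), so equivariance is the module law for A (x)
    X. *)
Lemma untwist_mx_eqv X a : is_amod X ->
  mrep (regular_mod (x) trivial_mod (mdim X)) a *m untwist_mx X =
  untwist_mx X *m mrep (regular_mod (x) X) a.
Proof.
move=> mX; have mA := is_amod_regular; have mAX := is_amod_tens mA mX.
have [lin _ mul] := mAX.
rewrite tens_trivialE //.
apply: tensmx_row_inj => i.
apply: etrans _ (esym (mulmxA _ _ _)).
rewrite [RHS](congr1 (fun M => M *m _) (untwist_mx_row i mX)) -mulmxA -mul mulmxA.
rewrite tensmx_mul mulmx1.
rewrite -rowE [row _ _]row_sum_delta tensmx_suml mulmx_suml.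
rewrite (hb_coord (a * hbe i)) linear_comb // mulmx_sumr.
apply: eq_bigr => j _.
rewrite tensmxZl -scalemxAl -scalemxAr !mxE; congr (_ *: _).
exact: (untwist_mx_row j mX).
Qed.

Lemma iso_regular_tens X : is_amod X ->
  iso_mod (regular_mod (x) trivial_mod (mdim X)) (regular_mod (x) X).
Proof.
(* A one-sided inverse of a square matrix is two-sided. *)
move=> mX; have VP := untwist_mxV mX; have [_ uP] := mulmx1_unit VP.
exists (untwist_mx X); split=> [||a].
- by rewrite row_free_unit.
- by rewrite row_full_unit.
- exact: untwist_mx_eqv.
Qed.

(** * Direct sums *)

Lemma is_amod_dsum W X : is_amod W -> is_amod X -> is_amod (dsum_mod W X).
Proof.
move=> [linW oneW mulW] [linX oneX mulX]; split=> [c x y||a b] /=.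
- by rewrite linW linX scale_block_mx add_block_mx !scaler0 !addr0.
- by rewrite oneW oneX scalar_mx_block.
- by rewrite mulW mulX mulmx_block !mulmx0 !mul0mx !addr0 !add0r.
Qed.

Lemma factor_dsum W X :
  exists U : 'M[F]_(mdim (dsum_mod W X)),
    [/\ submod U, factor_iso 0 U W & factor_iso U 1%:M X].
Proof.
pose P : 'M[F]_(mdim W, mdim W + mdim X) := row_mx 1%:M 0.
pose R : 'M[F]_(mdim X, mdim W + mdim X) := row_mx 0 1%:M.
pose pr : 'M[F]_(mdim W + mdim X, mdim W) := col_mx 1%:M 0.
pose qr : 'M[F]_(mdim W + mdim X, mdim X) := col_mx 0 1%:M.
have eqvP a : mrep W a *m P = P *m mrep (dsum_mod W X) a.
  by rewrite /P /= mul_mx_row mul_row_block !mul0mx !mul1mx !mulmx1 !mulmx0 !addr0.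
have eqvR a : mrep X a *m R = R *m mrep (dsum_mod W X) a.
  by rewrite /R /= mul_mx_row mul_row_block !mul0mx !mul1mx !mulmx1 !mulmx0 !add0r.
have Ppr : P *m pr = 1%:M by rewrite mul_row_col mul1mx mul0mx addr0.
have Pqr : P *m qr = 0 by rewrite mul_row_col mul1mx mul0mx addr0.
have Rqr : R *m qr = 1%:M by rewrite mul_row_col mul1mx mul0mx add0r.
exists <<P>>%MS; split.
- by move=> a; rewrite genmxE (eqmxMr _ (genmxE P)) -eqvP submxMl.
- apply/factor_isoP; exists P; split=> [m v||a].
  + move=> /submx0null vP.
    by rewrite -[v]mulmx1 -Ppr mulmxA vP mul0mx.
  + exact: eqmx_trans (addsmx0 _ _) (eqmx_sym (genmxE _)).
  + by rewrite eqvP subrr sub0mx.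
- apply/factor_isoP; exists R; split=> [m v||a].
  + rewrite genmxE => /submxP[D vR].
    by rewrite -[v]mulmx1 -Rqr mulmxA vR -mulmxA Pqr mulmx0.
  + apply/eqmxP; rewrite submx1 /=.
    have -> : 1%:M = qr *m R + pr *m P :> 'M[F]_(mdim W + mdim X).
      rewrite !mul_col_row !mulmx1 !mul0mx !mulmx0 add_block_mx !addr0 !add0r.
      exact: scalar_mx_block.
    by rewrite addmx_sub_adds // ?genmxE submxMl.
  + by rewrite eqvR subrr sub0mx.
Qed.

End HopfModules.

(** * Singular Z-matrices with positive null vectors *)

Section Reduction.
Variables (R : comNzRingType) (l : nat).
Implicit Types (L : 'M[R]_l.+1) (x : 'cV[R]_l) (u : 'rV[R]_l).

Definition reduced_mx L : 'M[R]_l :=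
  \matrix_(i, j) L (lift ord_max i) (lift ord_max j).

Definition ext_col x : 'cV[R]_l.+1 :=
  \col_i oapp (fun k => x k 0) 0 (unlift ord_max i).

Definition ext_row u : 'rV[R]_l.+1 :=
  \row_i oapp (fun k => u 0 k) 0 (unlift ord_max i).

Lemma sum_lift_max (f : 'I_l.+1 -> R) :
  \sum_i f i = f ord_max + \sum_(i < l) f (lift ord_max i).
Proof. by rewrite (bigD1_ord ord_max). Qed.

Lemma mul_ext_col L x i :
  (L *m ext_col x) (lift ord_max i) 0 = (reduced_mx L *m x) i 0.
Proof.
rewrite !mxE sum_lift_max !mxE unlift_none mulr0 add0r.
by apply: eq_bigr => j _; rewrite !mxE liftK.
Qed.

Lemma mul_ext_row L u i :
  (ext_row u *m L) 0 (lift ord_max i) = (u *m reduced_mx L) 0 i.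
Proof.
rewrite !mxE sum_lift_max !mxE unlift_none mul0r add0r.
by apply: eq_bigr => j _; rewrite !mxE liftK.
Qed.

End Reduction.

Lemma map_reduced_mx l (L : 'M[int]_l.+1) :
  map_mx (intr : int -> rat) (reduced_mx L) = reduced_mx (map_mx intr L).
Proof. by apply/matrixP=> i j; rewrite !mxE. Qed.

Lemma ord_max_liftP l (i : 'I_l.+1) :
  i = ord_max \/ exists k, i = lift ord_max k.
Proof.
by case: (unliftP ord_max i) => [k ->|->]; [right; exists k|left].
Qed.

Section SingularMatrix.
Variables (l : nat) (L : 'M[int]_l.+1) (p : 'cV[int]_l.+1) (s : 'rV[int]_l.+1).
Hypothesis L_offdiag : forall i j, i != j -> L i j <= 0.
Hypothesis p_gt0 : forall i, 0 < p i 0.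
Hypothesis Lp : L *m p = 0.
Hypothesis sL : s *m L = 0.
Hypothesis s_max : s 0 ord_max = 1.
Local Notation Q := (reduced_mx L).
Local Notation toQ := (map_mx (intr : int -> rat)).

(** A nonzero entry [L i j] off the diagonal is an edge from [j] to [i]. Reachability of every
    vertex from [ord_max] is expressed without paths: every closed set is everything. *)
Definition closed_pred (C : pred 'I_l.+1) :=
  C ord_max /\ forall i j, i != j -> C j -> L i j != 0 -> C i.

(** A left null vector of the reduced matrix, extended by 0, kills every column of [L] except
    perhaps the last; pairing with [p], whose last entry is positive, settles that one. *)
Lemma reduced_det0_null : \det Q = 0 ->
  exists u : 'rV[int]_l.+1, [/\ u != 0, u 0 ord_max = 0 & u *m L = 0].
Proof.
move/eqP/det0P=> [u u0 uQ]; exists (ext_row u); split.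
- apply: contra_neq u0 => u0; apply/rowP=> i.
  by move/rowP/(_ (lift ord_max i)): u0; rewrite !mxE liftK.
- by rewrite mxE unlift_none.
have uL i : (ext_row u *m L) 0 (lift ord_max i) = 0.
  by rewrite mul_ext_row uQ mxE.
apply/rowP=> i; rewrite [RHS]mxE; case: (ord_max_liftP i) => [->|[k ->] //].
have : (ext_row u *m L *m p) 0 0 = 0 by rewrite -mulmxA Lp mulmx0 mxE.
rewrite mxE sum_lift_max big1 ?addr0 => [/eqP|k _]; last by rewrite uL mul0r.
by rewrite mulf_eq0 (gt_eqF (p_gt0 _)) orbF => /eqP.
Qed.

Lemma rank_le : (\rank (toQ L) <= l)%N.
Proof.
rewrite -ltnS ltn_neqAle rank_leq_row andbT; apply/negP=> rk.
have : toQ s = 0.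
  by apply: (row_free_inj (A := toQ L) rk); rewrite -map_mxM sL mul0mx raddf0.
by move/rowP/(_ ord_max)/eqP; rewrite !mxE s_max.
Qed.

Lemma rank_reduced : \det Q != 0 -> \rank (toQ L) = l.
Proof.
move=> dQ; apply/eqP; rewrite eqn_leq rank_le /=.
have uQ : toQ Q \in unitmx by rewrite unitmxE det_map_mx unitfE intr_eq0.
rewrite -[X in (X <= _)%N](mxrank_unit uQ).
(* Selecting rows and columns cannot raise the rank. *)
have -> : toQ Q = rowsub (lift ord_max) 1%:M *m toQ L *m colsub (lift ord_max) 1%:M.
  rewrite mul_rowsub_mx mul1mx mulmx_colsub mulmx1.
  by apply/matrixP=> i j; rewrite !mxE.
by apply: leq_trans (mxrankM_maxl _ _) (mxrankM_maxr _ _).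
Qed.

(** With nullity 1 every left null vector is a multiple of [s]; one that vanishes at [ord_max],
    where [s] is 1, must be 0. *)
Lemma reduced_det_rank : \rank (toQ L) = l -> \det Q != 0.
Proof.
move=> rk; apply/negP=> /eqP/reduced_det0_null[u [u0 umax uL]].
have rker : \rank (kermx (toQ L)) = 1%N by rewrite mxrank_ker rk subSnn.
have inker (v : 'rV_l.+1) : v *m L = 0 -> (toQ v <= kermx (toQ L))%MS.
  by move=> vL; apply/sub_kermxP; rewrite -map_mxM vL raddf0.
have s0 : toQ s != 0.
  by apply/eqP=> /rowP/(_ ord_max)/eqP; rewrite !mxE s_max.
have [_] := mxrank_leqif_sup (inker s sL).
rewrite rker rank_rV s0 eqxx => /esym ks.
have /submxP[c uc] := submx_trans (inker u uL) ks.
have c0 : c 0 0 = 0.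
  move/rowP/(_ ord_max): uc; rewrite !mxE big_ord1 !mxE umax s_max.
  by rewrite mulr1 => <-.
case/negP: u0; apply/eqP/rowP=> i; rewrite [RHS]mxE.
move/rowP/(_ i)/eqP: uc; rewrite !mxE big_ord1 c0 mul0r intr_eq0.
by move/eqP.
Qed.

(* Row space of a projection: if no edge leaves C, the coordinates outside C
   span a Q-stable space, on which Q kills p; so Q is singular unless C is
   everything. *)
Lemma det_closed (C : pred 'I_l.+1) :
  \det Q != 0 -> closed_pred C -> forall i, C i.
Proof.
move=> dQ [Cmax Ccl] i; case: (ord_max_liftP i) => [->|[k ->]] //.
have [//|nCk] := boolP (C (lift ord_max k)).
pose d : 'rV[rat]_l := \row_j (~~ C (lift ord_max j))%:R.
pose D := diag_mx d; pose B := toQ Q.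
have uB : B \in unitmx by rewrite unitmxE det_map_mx unitfE intr_eq0.
pose q : 'cV[rat]_l := \col_j (p (lift ord_max j) 0)%:~R.
have noedge m j : ~~ C m -> C j -> L m j = 0.
  move=> nCm Cj; apply/eqP; apply: contraNT (nCm); apply: Ccl (Cj).
by apply: contraNneq nCm => ->.
have DBD : D *m B *m D = D *m B.
  rewrite mul_mx_diag mul_diag_mx; apply/matrixP=> m j; rewrite !mxE.
  have [Cj|_] := boolP (C (lift ord_max j)); last by rewrite mulr1.
  have [_|nCm] := boolP (C (lift ord_max m)); first by rewrite !mul0r.
  by rewrite noedge // mulr0 mul0r.
(* Rows of [L] outside [C] vanish in column [ord_max], since [ord_max] lies in [C]; so [L *m p = 0]
   survives the deletion of that column. *)
have DBq : D *m B *m q = 0.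
  rewrite -mulmxA mul_diag_mx; apply/colP=> m; rewrite !mxE.
  have [_|nCm] := boolP (C (lift ord_max m)); first by rewrite mul0r.
  rewrite mul1r; have /colP/(_ (lift ord_max m)) := Lp.
  rewrite !mxE sum_lift_max noedge // mul0r add0r => e0.
  rewrite -[RHS](rmorph0 (intr : int -> rat)) -e0 rmorph_sum.
  apply: eq_bigr => j _.
  by rewrite !mxE rmorphM.
(* [B] is invertible, so [D *m B] has the rank of [D] and the stable row space is all of [D]. Hence
   [D *m q = 0], against positivity of [p] at [k]. *)
have : (D <= D *m B)%MS.
  have le : (D *m B <= D)%MS by rewrite -DBD submxMl.
  by have [_ <-] := mxrank_leqif_sup le; rewrite mxrankMfree // row_free_unit.
case/submxP=> X defD.
have : (D *m q) k 0 = 0 by rewrite defD -mulmxA DBq mulmx0 mxE.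
rewrite mul_diag_mx !mxE nCk mul1r => /eqP; rewrite intr_eq0.
by rewrite (gt_eqF (p_gt0 _)).
Qed.

(* Minimum principle: at a minimum of x / p over the indices, the value
   c < 0 propagates along edges and contradicts reachability from ord_max,
   where x vanishes. *)
Lemma monotone_closed (x : 'cV[rat]_l) :
  (forall C, closed_pred C -> forall i, C i) ->
  (forall i, 0 <= (toQ Q *m x) i 0) -> forall i, 0 <= x i 0.
Proof.
move=> allC Qx i; rewrite leNgt; apply/negP=> xi.
pose q j : rat := (p j 0)%:~R.
have q_gt0 j : 0 < q j by rewrite ltr0z.
pose f k := x k 0 / q (lift ord_max k).
have [m _ minm] := @Order.TotalTheory.arg_minP _ rat _ i xpredT f isT.
pose c := f m.
have c_lt0 : c < 0.
  by apply: le_lt_trans (minm i isT) _; rewrite pmulr_llt0 ?invr_gt0.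
(* The shift is invisible to [L], as [L *m p = 0]. The vector [y] is nonnegative, zero at the
   minimiser [m] and, because [c < 0], positive at [ord_max]. *)
pose y := ext_col x - c *: toQ p.
have y_max : 0 < y ord_max 0.
  rewrite !mxE unlift_none sub0r oppr_gt0 pmulr_llt0 //; exact: q_gt0.
have yE k : y (lift ord_max k) 0 = x k 0 - c * q (lift ord_max k).
  by rewrite !mxE liftK.
have y_ge0 j : 0 <= y j 0.
  case: (ord_max_liftP j) => [->|[k ->]]; first exact: ltW.
  rewrite yE subr_ge0 -ler_pdivlMr //; exact: minm.
have Ly k : 0 <= (toQ L *m y) (lift ord_max k) 0.
  rewrite mulmxBr -scalemxAr -map_mxM Lp raddf0 scaler0 subr0 mul_ext_col.
  by rewrite -map_reduced_mx.
clearbody y.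
(* If [y] vanished at [a] but not at [b], with an edge from [b] to [a], row [a] of [L *m y] would be
   negative. *)
have Ccl : closed_pred (fun j => y j 0 != 0).
  split=> [|a b neab yb Lab]; first by rewrite gt_eqF.
  apply/eqP=> ya; case: (ord_max_liftP a) => [ea|[k ea]].
    by move: y_max; rewrite -ea ya ltxx.
  have := Ly k; rewrite -ea mxE (bigD1 b) //= leNgt => /negP[].
  rewrite !mxE; apply: (@le_lt_trans _ _ ((L a b)%:~R * y b 0)).
    rewrite gerDl; apply: sumr_le0 => j jb; rewrite mxE.
    have [<-|neaj] := eqVneq a j; first by rewrite ya mulr0.
    by rewrite mulr_le0_ge0 ?y_ge0 // lerz0 L_offdiag.
  rewrite nmulr_rlt0 ?lt0r ?yb ?y_ge0 // ltrz0 lt_neqAle Lab.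
  exact: L_offdiag.
have := allC _ Ccl (lift ord_max m).
by rewrite yE /c /f divfK ?subrr ?eqxx // gt_eqF.
Qed.

(** Monotonicity applied to a null vector and its negative gives invertibility; applied to the
    columns of the inverse, it gives their nonnegativity. *)
Lemma Mmatrix_closed :
  (forall C, closed_pred C -> forall i, C i) -> nonsing_Mmatrix (toQ Q).
Proof.
move=> allC; have mono := fun x => @monotone_closed x allC.
have uQ : toQ Q \in unitmx.
  rewrite -unitmx_tr unitmxE unitfE; apply/negP=> /det0P[v v0 vQ].
  have Qv : toQ Q *m v^T = 0 by apply: trmx_inj; rewrite trmx_mul trmxK vQ trmx0.
  case/negP: v0; apply/eqP/rowP=> i; rewrite [RHS]mxE; apply/eqP.
  have vge := mono v^T _ i; have vle := mono (- v^T) _ i.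
  rewrite !mxE in vge vle; rewrite eq_le -oppr_ge0.
  by rewrite vge ?vle // => j; rewrite ?mulmxN Qv !mxE ?oppr0.
split=> // [i j neij|i j].
  by rewrite !mxE lerz0 L_offdiag // (inj_eq lift_inj).
have := mono (col j (invmx (toQ Q))) _ i; rewrite mxE; apply=> k.
by rewrite colE mulmxA mulmxV // mul1mx mxE ler0n.
Qed.

(** * The kernel of [s] modulo the image of [L] *)

Definition finite_cokernel :=
  exists e : seq 'cV[int]_l.+1, forall x, s *m x = 0 ->
    exists2 y, y \in e & s *m y = 0 /\ exists z, x - y = L *m z.

(** A left null vector [u] of [L] is constant on cosets of the image of [L], yet takes infinitely
    many values on the kernel of [s]. *)
Lemma det_finite_cokernel : finite_cokernel -> \det Q != 0.
Proof.
case=> e fin; apply/negP=> /eqP/reduced_det0_null[u [u0 umax uL]].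
have [i ui] : exists i, u 0 i != 0.
  by apply/existsP; apply: contraNT u0 => /existsPn H; apply/eqP/rowP=> i;
    rewrite [RHS]mxE; apply/eqP; rewrite -[_ == _]negbK H.
(* Correcting the unit vector at [ord_max] puts [w] in the kernel of [s] without changing its
   pairing with [u], which vanishes there. *)
pose w : 'cV[int]_l.+1 := delta_mx i 0 - s 0 i *: delta_mx ord_max 0.
have mul_delta (v : 'rV[int]_l.+1) j : (v *m delta_mx j (0 : 'I_1)) 0 0 = v 0 j.
  by rewrite -colE mxE.
have sw : s *m w = 0.
  apply/matrixP=> a b; rewrite !ord1 mulmxBr -scalemxAr !mxE -!/(_ *m _).
  by have := mul_delta s i; have := mul_delta s ord_max; rewrite !mxE => -> ->;
    rewrite s_max mulr1 subrr.
have uw : (u *m w) 0 0 = u 0 i.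
  rewrite mulmxBr -scalemxAr !mxE.
  by have := mul_delta u i; have := mul_delta u ord_max; rewrite !mxE => -> ->;
    rewrite umax mulr0 subr0.
pose f (k : nat) := u 0 i * k%:Z.
have f_inj : injective f by move=> a b /(mulfI ui) [].
(* Pigeonhole: the values of [u] at [size e + 1] multiples of [w] are distinct, but all occur among
   its values on [e]. *)
have sub : {subset [seq f k | k <- iota 0 (size e).+1] <=
            [seq (u *m y) 0 0 | y <- e]}.
  move=> _ /mapP[k _ ->].
  have [|y ye [_ [z eqz]]] := fin (k%:Z *: w); first by rewrite -scalemxAr sw scaler0.
  apply/mapP; exists y => //.
  have : u *m (k%:Z *: w - y) = 0 by rewrite eqz mulmxA uL mul0mx.
  rewrite mulmxBr => /eqP; rewrite subr_eq0 => /eqP <-.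
  by rewrite -scalemxAr mxE uw /f mulrC.
have := uniq_leq_size _ sub; rewrite map_inj_uniq // iota_uniq.
by rewrite !size_map size_iota ltnn => /(_ isT).
Qed.

(** Representatives are given by residues modulo the determinant in all coordinates but the last,
    which [s] then fixes. The adjugate shows that multiples of the determinant come from the
    image. *)
Lemma finite_cokernel_det : \det Q != 0 -> finite_cokernel.
Proof.
move=> dQ; pose d := \det Q; pose N := `|d|%N.
pose mk (r : {ffun 'I_l -> 'I_N}) : 'cV[int]_l.+1 :=
  let b := ext_col (\col_k (r k : nat)%:Z) in
  b - (s *m b) 0 0 *: delta_mx ord_max 0.
have s_mk r : s *m mk r = 0.
  apply/matrixP=> a b; rewrite !ord1 /mk; set c := ext_col _.
  rewrite mulmxBr -scalemxAr -colE; rewrite !mxE s_max mulr1 subrr //.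
exists [seq mk r | r : {ffun 'I_l -> 'I_N}] => x sx.
have modN (k : 'I_l) : (`|(x (lift ord_max k) ord0 %% d)%Z| < N)%N.
  by have := ltz_mod (x (lift ord_max k) 0) dQ; rewrite -ltz_nat gez0_abs ?modz_ge0.
pose r : {ffun 'I_l -> 'I_N} := [ffun k => Ordinal (modN k)].
exists (mk r); first by apply/imageP; exists r.
split=> //; pose t : 'cV[int]_l := \col_k (x (lift ord_max k) ord0 %/ d)%Z.
(* [t] holds the quotients by [d], and [Q *m \adj Q] is the scalar [d]. *)
exists (ext_col (\adj Q *m t)).
have eqlift k : (x - mk r) (lift ord_max k) 0 =
    (L *m ext_col (\adj Q *m t)) (lift ord_max k) 0.
  rewrite mul_ext_col mulmxA mul_mx_adj mul_scalar_mx !mxE.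
  rewrite liftK /= !mxE ffunE /= gez0_abs ?modz_ge0 // eq_sym (negPf (neq_lift _ _)).
  rewrite mulr0 subr0 {1}(divz_eq (x (lift ord_max k) 0) d) addrK mulrC //.
apply/colP=> i; case: (ord_max_liftP i) => [->|[k ->] //].
(* Both vectors are killed by [s] and [s] is 1 at [ord_max], so agreement elsewhere forces agreement
   there. *)
have : s *m (x - mk r) = s *m (L *m ext_col (\adj Q *m t)).
  by rewrite mulmxA sL mul0mx mulmxBr sx s_mk subr0.
move/matrixP/(_ 0 0); rewrite ![(s *m _) 0 0]mxE !sum_lift_max s_max !mul1r.
rewrite (eq_bigr (fun k => s 0 (lift ord_max k) *
   (L *m ext_col (\adj Q *m t)) (lift ord_max k) 0)); last by move=> k _; rewrite eqlift.
by move/addIr.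
Qed.

End SingularMatrix.

(** * The McKay matrix *)

Section GrothendieckRing.
Variables (F : fieldType) (A : falgType F).
Variables (delta : A -> 'M[F]_(hdim A)) (eps : A -> F) (S : A -> A).
Variables (l : nat) (Sm : 'I_l.+1 -> amod A).
Hypothesis hopf : is_hopf delta eps S.
Hypothesis classes : simple_classes eps Sm.
Implicit Types (W X Q V : amod A).
Local Notation "W (x) X" := (tens_mod delta W X) (at level 40).
Local Notation tens_amod := (is_amod_tens hopf).

Let Sm_simple : forall i, simple_mod (Sm i). Proof. by case: classes. Qed.
Let Sm_inj : forall i j, iso_mod (Sm i) (Sm j) -> i = j. Proof. by case: classes. Qed.
Let Sm_all : forall W, simple_mod W -> exists i, iso_mod W (Sm i).
Proof. by case: classes. Qed.
Let Sm_amod i : is_amod (Sm i). Proof. by case: (Sm_simple i). Qed.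
Let mult_chain := mult_chain Sm_simple Sm_inj Sm_all.
Let full_chain_exists := full_chain_exists Sm_all.

Lemma sum_count_mem (s : seq 'I_l.+1) (f : 'I_l.+1 -> nat) :
  (\sum_(j <- s) f j = \sum_j count_mem j s * f j)%N.
Proof.
elim: s => [|i s IH]; first by rewrite big_nil big1.
rewrite big_cons IH [RHS](eq_bigr (fun j => (i == j) * f j + count_mem j s * f j)%N).
  rewrite big_split /=; congr (_ + _)%N.
  rewrite (bigD1 i) //= eqxx mul1n big1 ?addn0 // => j.
  by rewrite eq_sym => /negPf->.
by move=> j _; rewrite /= mulnDl.
Qed.

Lemma count_flatten_map (s : seq 'I_l.+1) (t : 'I_l.+1 -> seq 'I_l.+1) i :
  (count_mem i (flatten (map t s)) = \sum_j count_mem j s * count_mem i (t j))%N.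
Proof.
rewrite -sum_count_mem; elim: s => [|j s IH]; first by rewrite big_nil.
by rewrite /= count_cat IH big_cons.
Qed.

(** Tensoring a series of [W] with [X] leaves steps with quotients [Sm j (x) X], each of which is
    refined by its own series [t j]. *)
Lemma chain_tensl W X (U1 U2 : 'M[F]_(mdim W)) s (t : 'I_l.+1 -> seq 'I_l.+1) :
  (forall j, full_chain Sm (Sm j (x) X) (t j)) -> chain Sm U1 U2 s ->
  @chain _ _ _ Sm (W (x) X) (U1 *t 1%:M) (U2 *t 1%:M) (flatten (map t s)).
Proof.
move=> ct; elim: s U2 => [|i s IH] U2 /=.
  by move=> e; apply/eqmxP; rewrite !submx_tensl ?e.
case=> Z [sZ cZ fZ]; apply: chain_cat (IH _ cZ) _.
by apply: chain_factor (ct i); [apply: submod_tensl|apply: factor_tensl].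
Qed.

Lemma chain_tensr W X (U1 U2 : 'M[F]_(mdim W)) s (t : 'I_l.+1 -> seq 'I_l.+1) :
  (forall j, full_chain Sm (X (x) Sm j) (t j)) -> chain Sm U1 U2 s ->
  @chain _ _ _ Sm (X (x) W) (1%:M *t U1) (1%:M *t U2) (flatten (map t s)).
Proof.
move=> ct; elim: s U2 => [|i s IH] U2 /=.
  by move=> e; apply/eqmxP; rewrite !submx_tensr ?e.
case=> Z [sZ cZ fZ]; apply: chain_cat (IH _ cZ) _.
by apply: chain_factor (ct i); [apply: submod_tensr|apply: factor_tensr].
Qed.

Lemma mult_tensl W X i : is_amod W -> is_amod X ->
  mult (W (x) X) (Sm i) = (\sum_j mult W (Sm j) * mult (Sm j (x) X) (Sm i))%N.
Proof.
move=> mW mX; have mSX j := tens_amod (Sm_amod j) mX.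
have /fin_all_exists[t ct] j := full_chain_exists (mSX j).
have [s cs] := full_chain_exists mW.
have := chain_tensl ct cs; rewrite tens0mx tensmx1.
move=> /(mult_chain i (tens_amod mW mX)) ->.
rewrite count_flatten_map; apply: eq_bigr => j _.
by rewrite (mult_chain j mW cs) (mult_chain i (mSX j) (ct j)).
Qed.

Lemma mult_tensr W X i : is_amod W -> is_amod X ->
  mult (X (x) W) (Sm i) = (\sum_j mult W (Sm j) * mult (X (x) Sm j) (Sm i))%N.
Proof.
move=> mW mX; have mSX j := tens_amod mX (Sm_amod j).
have /fin_all_exists[t ct] j := full_chain_exists (mSX j).
have [s cs] := full_chain_exists mW.
have := chain_tensr ct cs; rewrite tensmx0 tensmx1.
move=> /(mult_chain i (tens_amod mX mW)) ->.
rewrite count_flatten_map; apply: eq_bigr => j _.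
by rewrite (mult_chain j mW cs) (mult_chain i (mSX j) (ct j)).
Qed.

Lemma mult_dsum W X i : is_amod W -> is_amod X ->
  mult (dsum_mod W X) (Sm i) = (mult W (Sm i) + mult X (Sm i))%N.
Proof.
move=> mW mX; have [s cs] := full_chain_exists mW.
have [t ct] := full_chain_exists mX.
have [U [sU fW fX]] := factor_dsum W X.
have c := chain_cat (chain_factor (submod0 _) fW cs) (chain_factor sU fX ct).
rewrite (mult_chain i (is_amod_dsum mW mX) c) count_cat addnC.
by rewrite (mult_chain i mW cs) (mult_chain i mX ct).
Qed.

Let multI := mult_iso Sm_simple Sm_inj Sm_all.

Lemma mult_simple i j : mult (Sm j) (Sm i) = (j == i).
Proof.
rewrite (mult_chain (s := [:: j]) i (Sm_amod j)) /= ?addn0 //.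
exists 0; split=> //; first exact: submod0.
apply: iso_factor; exists 1%:M; split=> [||a].
- by rewrite row_free_unit unitmx1.
- by rewrite row_full_unit unitmx1.
- by rewrite mulmx1 mul1mx.
Qed.

Lemma mult_triv i : mult (triv_mod eps) (Sm i) = (ord_max == i).
Proof.
rewrite -mult_simple; apply: esym; apply: multI => //.
  exact: (is_amod_trivial hopf 1).
by case: classes.
Qed.

Lemma mult_trivial n i : mult (trivial_mod eps n) (Sm i) = (n * (ord_max == i))%N.
Proof.
elim: n => [|n IH].
  rewrite (mult_chain (s := [::]) i (is_amod_trivial hopf 0)) //.
  by rewrite /full_chain /= [1%:M]flatmx0; apply: eqmx_refl.
have m1 := is_amod_trivial hopf 1; have mn := is_amod_trivial hopf n.
rewrite mulSn -IH -mult_triv -(mult_dsum i m1 mn).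
apply: multI; [exact: (is_amod_trivial hopf n.+1)|exact: is_amod_dsum|].
exists (1%:M : 'M_(1 + n)); split=> [||a].
- by rewrite row_free_unit unitmx1.
- by rewrite row_full_unit unitmx1.
- rewrite mulmx1 mul1mx; exact: (scalar_mx_block 1 n (eps a)).
Qed.

Lemma mult_tens_triv W i : is_amod W ->
  mult (W (x) Sm ord_max) (Sm i) = mult W (Sm i).
Proof.
move=> mW; have mt := is_amod_trivial hopf 1 : is_amod (triv_mod eps).
rewrite -(multI i (tens_amod mW mt) mW (iso_tens_trivial1 hopf mW)) [RHS]mult_tensr //.
rewrite (bigD1 ord_max) //= mult_triv eqxx mul1n big1 ?addn0 // => j.
by rewrite mult_triv eq_sym => /negPf->.
Qed.

Lemma mult_regular_gt0 i : (0 < mult (regular_mod A) (Sm i))%N.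
Proof.
have mA := is_amod_regular A.
have [U sU fU] := simple_regular_quot (Sm_simple i).
have [s cs] := chain_exists Sm_all mA (submod0 _) sU (sub0mx _ _).
have c : full_chain Sm (regular_mod A) (i :: s) by exists U.
by rewrite (mult_chain i mA c) /= eqxx.
Qed.

(** Both sides count the factor [Sm i] of A (x) V: the left through a series of A, the right by
    untwisting A (x) V into [mdim V] copies of A. *)
Lemma mult_regular_tens V i : is_amod V ->
  (\sum_j mult (Sm j (x) V) (Sm i) * mult (regular_mod A) (Sm j) =
   mdim V * mult (regular_mod A) (Sm i))%N.
Proof.
move=> mV; have mA := is_amod_regular A.
under eq_bigr do rewrite mulnC.
rewrite -mult_tensl //.
have mT := is_amod_trivial hopf (mdim V).
rewrite -(multI i (tens_amod mA mT) (tens_amod mA mV) (iso_regular_tens hopf mV)).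
rewrite mult_tensr // (bigD1 ord_max) //= mult_trivial eqxx muln1 mult_tens_triv //.
rewrite big1 ?addn0 // => j.
by rewrite mult_trivial eq_sym => /negPf->; rewrite muln0.
Qed.

(** * Null vectors, critical group and tensor-richness for the matrix of V *)

Section Laplacian.
Variable V : amod A.
Hypothesis mV : is_amod V.
Local Notation M := (mckay delta Sm V).
Local Notation L := (lapl delta Sm V).

(** [regular_col] and [dim_row] serve as the null vectors [p] and [s] of the matrix section. *)
Definition regular_col : 'cV[int]_l.+1 := \col_i (mult (regular_mod A) (Sm i))%:Z.
Definition dim_row : 'rV[int]_l.+1 := \row_i (mdim (Sm i))%:Z.

Lemma lapl_regular : L *m regular_col = 0.
Proof.
rewrite mulmxBl mul_scalar_mx; apply/colP=> i; rewrite !mxE; apply/eqP.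
rewrite subr_eq0 -PoszM -mult_regular_tens // -natz natr_sum; apply/eqP.
by apply: eq_bigr => j _; rewrite !mxE natrM !natz.
Qed.

(** Dimension is additive over composition factors and multiplicative on tensor products. *)
Lemma dim_lapl : dim_row *m L = 0.
Proof.
rewrite mulmxBr mul_mx_scalar; apply/rowP=> j; rewrite !mxE; apply/eqP.
rewrite subr_eq0 -PoszM mulnC.
rewrite -[(_ * _)%N]/(mdim (Sm j (x) V)).
rewrite (dim_mult Sm_simple Sm_inj Sm_all (tens_amod (Sm_amod j) mV)).
rewrite -natz natr_sum; apply/eqP.
by apply: eq_bigr => i _; rewrite !mxE natrM !natz mulrC.
Qed.

Lemma lapl_offdiag i j : i != j -> L i j <= 0.
Proof. by move=> neij; rewrite !mxE (negPf neij) sub0r oppr_le0. Qed.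

Lemma lapl_edge i j : i != j -> (L i j != 0) = (0 < mult (Sm j (x) V) (Sm i))%N.
Proof. by move=> neij; rewrite !mxE (negPf neij) sub0r oppr_eq0 lt0n. Qed.

Lemma dim_row_max : dim_row 0 ord_max = 1.
Proof.
case: classes => _ _ _ [P [Pfree Pfull _]].
by rewrite mxE; have := eqP Pfree; rewrite (eqP Pfull) /= => <-.
Qed.

Lemma g0augE x : g0aug Sm x = (dim_row *m x) 0 0.
Proof. by rewrite mxE; apply: eq_bigr => i _; rewrite !mxE mulrC. Qed.

(** [S_j][V] is column [j] of the McKay matrix and [S_j] times the trivial class is [S_j]. Hence the
    subgroup divided out in K(V) is the image of [L]. *)
Lemma g0mul_lapl z :
  g0mul delta Sm z ((mdim V)%:Z *: g0one eps Sm - g0cls Sm V) = L *m z.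
Proof.
have mt := is_amod_trivial hopf 1 : is_amod (triv_mod eps).
apply/colP=> i; rewrite /g0mul summxE mulmxBl mul_scalar_mx mxE.
have colX X j : is_amod X ->
    \sum_k (z j 0 * (mult X (Sm k))%:Z) * (mult (Sm j (x) Sm k) (Sm i))%:Z
    = z j 0 * (mult (Sm j (x) X) (Sm i))%:Z.
  move=> mX; rewrite mult_tensr // -[(\sum_k _)%N%:Z]natz natr_sum mulr_sumr.
  by apply: eq_bigr => k _; rewrite natrM !natz mulrA.
have triv_j j : mult (Sm j (x) triv_mod eps) (Sm i) = (j == i).
  rewrite -mult_simple; apply: multI (tens_amod (Sm_amod j) mt) (Sm_amod j) _.
  exact: (iso_tens_trivial1 hopf (Sm_amod j)).
transitivity (\sum_j ((mdim V)%:Z * (z j 0 * (j == i)%:Z) - M i j * z j 0)).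
  apply: eq_bigr => j _; rewrite summxE -triv_j -colX // mxE [_ * z j 0]mulrC -colX //.
  rewrite mulr_sumr -sumrB; apply: eq_bigr => k _.
  by rewrite !mxE; ring.
rewrite sumrB -mulr_sumr (bigD1 i) //= eqxx mulr1 big1 ?addr0 => [|j /negPf->].
  by rewrite !mxE.
by rewrite mulr0.
Qed.

Lemma critical_group_cokernel :
  critical_group_finite delta eps Sm V <-> finite_cokernel L dim_row.
Proof.
split=> -[e fin]; exists e => x.
  move=> sx; have [|y ye [sy [z xyz]]] := fin x; first by rewrite g0augE sx mxE.
  exists y => //; split; last by exists z; rewrite -g0mul_lapl.
  by apply/matrixP=> a b; rewrite !ord1 -g0augE sy mxE.
rewrite g0augE => sx; have [|y ye [sy [z xyz]]] := fin x.
  by apply/matrixP=> a b; rewrite !ord1 sx mxE.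
exists y => //; split; first by rewrite g0augE sy mxE.
by exists z; rewrite g0mul_lapl.
Qed.

Lemma is_amod_tpow k : is_amod (tpow delta eps V k).
Proof. by elim: k => [|k IH]; [exact: (is_amod_trivial hopf 1)|exact: tens_amod]. Qed.

Lemma is_amod_tsum t : is_amod (tsum delta eps V t).
Proof.
elim: t => [|t IH]; first exact: (is_amod_tpow 0).
exact: is_amod_dsum IH (is_amod_tpow t.+1).
Qed.

Lemma mult_tsum t i :
  mult (tsum delta eps V t) (Sm i) = (\sum_(k < t.+1) mult (tpow delta eps V k) (Sm i))%N.
Proof.
elim: t => [|t IH]; first by rewrite big_ord1.
rewrite big_ord_recr -IH.
exact: mult_dsum (is_amod_tsum t) (is_amod_tpow t.+1).
Qed.

Lemma tpow_edge k i j : (0 < mult (tpow delta eps V k) (Sm j))%N ->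
  (0 < mult (Sm j (x) V) (Sm i))%N -> (0 < mult (tpow delta eps V k.+1) (Sm i))%N.
Proof.
move=> pj pij; rewrite [tpow _ _ _ _]/= (mult_tensl i (is_amod_tpow k) mV).
by rewrite (bigD1 j) //= addn_gt0 muln_gt0 pj pij.
Qed.

(** By induction on the power, factors of tensor powers stay in every closed set. Conversely the
    simples occurring in some power form a closed set, and one [t] exceeds all the exponents
    needed. *)
Lemma tensor_rich_closed :
  tensor_rich delta eps Sm V <-> (forall C, closed_pred L C -> forall i, C i).
Proof.
split=> [[t [_ rich_t]] C [Cmax Ccl] i|allC].
  have Cpow k j : (0 < mult (tpow delta eps V k) (Sm j))%N -> C j.
    elim: k j => [|k IH] j; first by rewrite mult_triv lt0b => /eqP <-.
    rewrite [tpow _ _ _ _]/= (mult_tensl j (is_amod_tpow k) mV) lt0n sum_nat_eq0.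
    case/forallPn=> m; rewrite /= -lt0n muln_gt0 => /andP[pm pmj].
    (* Diagonal entries are not edges; in that case [j] already occurs in the previous power. *)
    have [->|nejm] := eqVneq j m; first exact: IH.
    by apply: (Ccl _ _ nejm (IH m pm)); rewrite lapl_edge.
  have := rich_t i; rewrite mult_tsum lt0n sum_nat_eq0 => /forallPn[k].
  by rewrite /= -lt0n; apply: Cpow.
pose C i := pbool (exists k, 0 < mult (tpow delta eps V k) (Sm i))%N.
have CC : closed_pred L C.
  split=> [|i j neij /pboolP[k pk]].
    by apply/pboolP; exists 0%N; rewrite mult_triv eqxx.
  by rewrite lapl_edge // => pij; apply/pboolP; exists k.+1; apply: tpow_edge pij.
have /fin_all_exists[k pk] i := pboolP _ (allC C CC i).
(* The successor keeps [t] positive even if every exponent is 0. *)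
exists (\max_i k i).+1; split=> // i; rewrite mult_tsum.
have lt : (k i < (\max_i k i).+2)%N.
  by rewrite ltnS (leq_trans (leq_bigmax i)).
by rewrite (bigD1 (Ordinal lt)) //= addn_gt0 pk.
Qed.

End Laplacian.
End GrothendieckRing.

Theorem theorem1p4 (F : closedFieldType) (A : falgType F)
    (delta : A -> 'M[F]_(hdim A)) (eps : A -> F) (S : A -> A)
    (l : nat) (Sm : 'I_l.+1 -> amod A) (V : amod A) :
  is_hopf delta eps S ->
  simple_classes eps Sm ->
  is_amod V ->
  [<-> nonsing_Mmatrix (map_mx (intr : int -> rat) (red_lapl delta Sm V));
       \det (red_lapl delta Sm V) != 0;
       \rank (map_mx (intr : int -> rat) (lapl delta Sm V)) = l;
       critical_group_finite delta eps Sm V;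
       tensor_rich delta eps Sm V].
Proof.
move=> hopf classes mV.
have off := @lapl_offdiag F A delta l Sm V.
have Lp := lapl_regular hopf classes mV; have sL := dim_lapl hopf classes mV.
have s_max := dim_row_max classes.
have p_gt0 i : 0 < regular_col Sm i 0.
  by rewrite mxE ltz_nat; exact: mult_regular_gt0 classes i.
have crit := critical_group_cokernel hopf classes mV.
have richC := tensor_rich_closed hopf classes mV.
have redE : red_lapl delta Sm V = reduced_mx (lapl delta Sm V) by [].
(* The implications form a cycle in the stated order; rank to finiteness and finiteness to richness
   both pass through the nonvanishing reduced determinant. *)
rewrite redE; tfae.
- by case=> _; rewrite unitmxE det_map_mx unitfE intr_eq0.
- exact: rank_reduced sL s_max.
- move=> rk; apply/crit; apply: (finite_cokernel_det sL s_max).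
  exact: reduced_det_rank p_gt0 Lp sL s_max rk.
- move/crit/(det_finite_cokernel p_gt0 Lp s_max) => dQ; apply/richC => C CC.
  exact: det_closed p_gt0 Lp C dQ CC.
- by move/richC; apply: Mmatrix_closed off p_gt0 Lp.
Qed.
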